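(* Let $q\in L^1(0,\infty)$ be real-valued and let $H^N$ be the self-adjoint operator in $L^2(0,\infty)$ given by $H^N\varphi=-\varphi''+(x+q(x))\varphi$ on the domain of $\varphi\in L^2(0,\infty)$ with $\varphi,\varphi'$ locally absolutely continuous on $[0,\infty)$, $-\varphi''+(x+q)\varphi\in L^2(0,\infty)$, and $\varphi'(0)=0$. Let $\lambda_1^N<\lambda_2^N<\cdots$ be its eigenvalues (its spectrum consists of simple eigenvalues, listed increasingly). Then \[ \lambda_k^N=\left(\tfrac32\pi\big(k-\tfrac34\big)\right)^{2/3}\big(1+O(k^{-1})\big),\qquad k\to\infty. \] *)

(* Defs.v *)
From HB Require Import structures.
From mathcomp Require Import all_boot all_order all_algebra.
From mathcomp Require Import all_classical all_reals all_analysis.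
Set Implicit Arguments. Unset Strict Implicit. Unset Printing Implicit Defensive.
Import Order.TTheory GRing.Theory Num.Theory.
Import numFieldNormedType.Exports.
Local Open Scope classical_set_scope.
Local Open Scope ring_scope.

Definition abs_cont_on (R : realType) (a b : R) (f : R -> R) : Prop :=
  forall eps : R, 0 < eps -> exists2 delta : R, 0 < delta &
    forall (n : nat) (s t : nat -> R),
      (forall i, (i < n)%N -> a <= s i /\ s i <= t i /\ t i <= b) ->
      (forall i, (i.+1 < n)%N -> t i <= s i.+1) ->
      \sum_(i < n) (t i - s i) < delta ->
      \sum_(i < n) `|f (t i) - f (s i)| < eps.

Definition loc_abs_cont (R : realType) (f : R -> R) : Prop :=
  forall b : R, 0 < b -> abs_cont_on 0 b f.

(* mu is an eigenvalue of the Neumann operator H^N = -d^2/dx^2 + (x + q(x))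
   in L^2(0,oo) with boundary condition phi'(0) = 0: there is a non-zero
   phi in the domain of H^N with H^N phi = mu phi.  Here dphi plays the role
   of phi' (phi, phi' locally absolutely continuous on [0,oo), phi' = dphi a.e.),
   and the eigenvalue equation -phi'' + (x + q) phi = mu phi holds a.e. on (0,oo).
   (The condition -phi'' + (x+q)phi in L^2 is then automatic, being mu phi.) *)
Definition neumann_eigenvalue (R : realType) (q : R -> R) (mu : R) : Prop :=
  exists phi dphi : R -> R,
    loc_abs_cont phi /\ loc_abs_cont dphi /\
    {ae (@lebesgue_measure R), forall x, (x : R) \in `]0, +oo[%classic ->
       is_derive x 1 phi (dphi x)} /\
    {ae (@lebesgue_measure R), forall x, (x : R) \in `]0, +oo[%classic ->
       derivable dphi x 1 /\ - ('D_1 dphi x) + (x + q x) * phi x = mu * phi x} /\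
    dphi 0 = 0 /\
    (@lebesgue_measure R).-integrable `[0, +oo[%classic
       (fun x => ((phi x) ^+ 2)%:E) /\
    ~ {ae (@lebesgue_measure R), forall x, (x : R) \in `[0, +oo[%classic -> phi x = 0}.

(* Main.v *)
Require Import Defs.
From HB Require Import structures.
From mathcomp Require Import all_boot all_order all_algebra.
From mathcomp Require Import all_classical all_reals all_analysis.
From mathcomp Require Import ring lra.
Import Order.TTheory GRing.Theory Num.Theory.
Import numFieldNormedType.Exports.
Local Open Scope classical_set_scope.
Local Open Scope ring_scope.

(** The asymptotics only say that the number of eigenvalues below lambda is
    (2 / (3 pi)) lambda^(3/2) + O(1), which is read off from a Pruefer angle.

    Regularization.  With T a primitive of q and Q x = T x - int_x^(x+1) T, the
    quasi-derivative w = phi' - Q phi turns the equation into the system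
    phi' = Q phi + w, w' = (x - lambda + p) phi - Q w, whose coefficients Q and
    p = T (x+1) - T x - Q^2 are continuous, bounded and integrable.

    Counting.  The angle theta(x, lambda) of (phi, w), started at the Neumann
    condition, increases with lambda, crosses multiples of pi only upwards and, for x
    beyond the turning point, crosses n pi + pi/2 only downwards; there
    (phi w)' >= phi^2 + w^2, so that lambda is an eigenvalue iff theta stays in some
    ]n pi + pi/2, (n+1) pi[.  Distinct eigenvalues have distinct n (Wronskian), and every
    large n occurs (supremum of the lambda for which theta falls below n pi + pi/2).

    Asymptotics.  With k = sqrt (lambda - x), the angle of (k phi, w), corrected by
    (k'/(4 k^2)) cos (2 angle), has derivative k + O(|Q| + |p| + k^-5) up to x = lambda - 1,
    hence theta = (2/3) lambda^(3/2) + O(1) at the turning point. *)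

Set Implicit Arguments. Unset Strict Implicit. Unset Printing Implicit Defensive.

(** * Calculus on the half-line *)

(** A relative error of order 1/k in the k-th eigenvalue is an additive O(1) in its index, so the
    offset between k and the index n has only to be eventually constant; it is never computed. For
    the same reason bounded errors in the angle suffice, including the whole stretch around the
    turning point. Since q is merely integrable, the equation holds almost everywhere and q has no
    pointwise bound. A primitive of q is bounded but need not be integrable, so taking it for Q
    would leave an error growing with lambda. Subtracting its mean over a unit window leaves
    quantities dominated by the variation of the primitive over that window, and this majorant is
    integrable. For the wave number k = sqrt (lambda - x), the uncorrected angle of (k phi, w) has
    the term (k'/k) sin cos with k'/k = -1/(2 k^2), whose absolute value integrates to order log
    lambda. The cosine correction trades it for terms of order (lambda - x)^(-5/2), integrable up to
    lambda - 1 uniformly in lambda. *)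

Section pointwise_rules.
Context {R : realType}.
Implicit Types (f g : R -> R).

Lemma contD f g : continuous f -> continuous g -> continuous (fun x => f x + g x).
Proof. by move=> cf cg x; apply: continuousD; [exact: cf|exact: cg]. Qed.

Lemma contN f : continuous f -> continuous (fun x => - f x).
Proof. by move=> cf x; apply: continuousN; exact: cf. Qed.

Lemma contM f g : continuous f -> continuous g -> continuous (fun x => f x * g x).
Proof. by move=> cf cg x; apply: continuousM; [exact: cf|exact: cg]. Qed.

Lemma contX f n : continuous f -> continuous (fun x => f x ^+ n).
Proof.
move=> cf; elim: n => [|n IH]; first by move=> x; exact: cst_continuous.
rewrite (_ : (fun x => _) = (fun x => f x * f x ^+ n)); first exact: contM.
by apply/funext => x; rewrite exprS.
Qed.

Lemma contcomp f g : continuous f -> continuous g -> continuous (fun x => f (g x)).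
Proof. by move=> cf cg x; apply: continuous_comp; [exact: cg|exact: cf]. Qed.

Lemma contid : continuous (fun x : R => x).
Proof. by move=> x; exact: cvg_id. Qed.

Lemma cont_sin f : continuous f -> continuous (fun x => sin (f x)).
Proof. by move=> cf; apply: contcomp => //; exact: continuous_sin. Qed.

Lemma cont_cos f : continuous f -> continuous (fun x => cos (f x)).
Proof. by move=> cf; apply: contcomp => //; exact: continuous_cos. Qed.

Lemma cont_exp f : continuous f -> continuous (fun x => expR (f x)).
Proof. by move=> cf; apply: contcomp => //; exact: continuous_expR. Qed.

Lemma cont_norm f : continuous f -> continuous (fun x => `|f x|).
Proof. by move=> cf; apply: contcomp => //; exact: norm_continuous. Qed.

Lemma der_eq f (x a b : R) : is_derive x 1 f a -> a = b -> is_derive x 1 f b.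
Proof. by move=> + <-. Qed.

Lemma der_cst (c x : R) : is_derive x 1 (fun _ : R => c) 0.
Proof. exact: is_derive_cst. Qed.

Lemma der_id (x : R) : is_derive x 1 (fun y : R => y) 1.
Proof. exact: is_derive_id. Qed.

Lemma derD f g (x a b : R) : is_derive x 1 f a -> is_derive x 1 g b ->
  is_derive x 1 (fun y => f y + g y) (a + b).
Proof. by move=> ? ?; exact: is_deriveD. Qed.

Lemma derN f (x a : R) : is_derive x 1 f a -> is_derive x 1 (fun y => - f y) (- a).
Proof. by move=> ?; exact: is_deriveN. Qed.

Lemma derM f g (x a b : R) : is_derive x 1 f a -> is_derive x 1 g b ->
  is_derive x 1 (fun y => f y * g y) (a * g x + f x * b).
Proof. by move=> ? ?; apply: is_derive_eq; rewrite /GRing.scale/=; ring. Qed.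

Lemma derX f n (x a : R) : is_derive x 1 f a ->
  is_derive x 1 (fun y => f y ^+ n) (n%:R * f x ^+ n.-1 * a).
Proof.
move=> fa; elim: n => [|n IH].
  rewrite (_ : (fun y => _) = fun=> 1); last by apply/funext => y; rewrite expr0.
  by rewrite !mul0r; exact: der_cst.
rewrite (_ : (fun y => _) = (fun y => f y * f y ^+ n)); last first.
  by apply/funext => y; rewrite exprS.
refine (der_eq (derM fa IH) _).
case: n {IH} => [|n] /=; first by rewrite !expr0; ring.
by rewrite -[n.+2]addn1 natrD exprS; ring.
Qed.

Lemma derV f (x a : R) : f x != 0 -> is_derive x 1 f a ->
  is_derive x 1 (fun y => (f y)^-1) (- a / f x ^+ 2).
Proof.
move=> fx fa; refine (der_eq (is_deriveV fx fa) _).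
by rewrite /GRing.scale/= !mulNr mulrC.
Qed.

Lemma der_comp f g (x a b : R) : is_derive (g x) 1 f a -> is_derive x 1 g b ->
  is_derive x 1 (fun y => f (g y)) (a * b).
Proof. by move=> ? ?; exact: is_derive1_comp. Qed.

Lemma der_sin f (x a : R) : is_derive x 1 f a ->
  is_derive x 1 (fun y => sin (f y)) (cos (f x) * a).
Proof. by move=> ?; apply: der_comp. Qed.

Lemma der_cos f (x a : R) : is_derive x 1 f a ->
  is_derive x 1 (fun y => cos (f y)) (- sin (f x) * a).
Proof. by move=> ?; apply: der_comp. Qed.

Lemma der_exp f (x a : R) : is_derive x 1 f a ->
  is_derive x 1 (fun y => expR (f y)) (expR (f x) * a).
Proof. by move=> ?; apply: der_comp. Qed.

Lemma der_atan f (x a : R) : is_derive x 1 f a ->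
  is_derive x 1 (fun y => atan (f y)) ((1 + f x ^+ 2)^-1 * a).
Proof. by move=> ?; apply: der_comp. Qed.

End pointwise_rules.

Ltac cont := repeat first [assumption | match goal with
  | |- continuous (fun x => x) => exact contid
  | |- continuous (fun _ => ?c) => exact: cst_continuous
  | |- continuous (fun x => @?f x + @?g x) => refine (@contD _ f g _ _)
  | |- continuous (fun x => - @?f x) => refine (@contN _ f _)
  | |- continuous (fun x => @?f x * @?g x) => refine (@contM _ f g _ _)
  | |- continuous (fun x => @?f x ^+ ?n) => refine (@contX _ f n _)
  | |- continuous (fun x => sin (@?f x)) => refine (@cont_sin _ f _)
  | |- continuous (fun x => cos (@?f x)) => refine (@cont_cos _ f _)
  | |- continuous (fun x => expR (@?f x)) => refine (@cont_exp _ f _)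
  | |- continuous (fun x => `|@?f x|) => refine (@cont_norm _ f _)
  end; cbv beta].

(* Leaves [f x != 0] goals for inverses. *)
Ltac der := repeat first [eassumption | match goal with
  | |- is_derive ?x _ (fun y => y) _ => exact (der_id x)
  | |- is_derive ?x _ (fun _ => ?c) _ => exact (der_cst c x)
  | |- is_derive ?x _ (fun y => @?f y + @?g y) _ => notypeclasses refine (@derD _ f g x _ _ _ _)
  | |- is_derive ?x _ (fun y => - @?f y) _ => notypeclasses refine (@derN _ f x _ _)
  | |- is_derive ?x _ (fun y => @?f y * @?g y) _ => notypeclasses refine (@derM _ f g x _ _ _ _)
  | |- is_derive ?x _ (fun y => @?f y ^+ ?n) _ => notypeclasses refine (@derX _ f n x _ _)
  | |- is_derive ?x _ (fun y => (@?f y)^-1) _ => notypeclasses refine (@derV _ f x _ _ _)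
  | |- is_derive ?x _ (fun y => sin (@?f y)) _ => notypeclasses refine (@der_sin _ f x _ _)
  | |- is_derive ?x _ (fun y => cos (@?f y)) _ => notypeclasses refine (@der_cos _ f x _ _)
  | |- is_derive ?x _ (fun y => expR (@?f y)) _ => notypeclasses refine (@der_exp _ f x _ _)
  | |- is_derive ?x _ (fun y => atan (@?f y)) _ => notypeclasses refine (@der_atan _ f x _ _)
  end; cbv beta].

Ltac der_to := notypeclasses refine (der_eq _ _); [der|cbv beta].

Section calculus.
Context {R : realType}.
Implicit Types (f g df d : R -> R) (a b x y : R).
Notation mu := (@lebesgue_measure R).

(** Differentiability is asked inside the interval only, because the solutions below are
    differentiable for x > 0 while the estimates start at 0. *)
Lemma derive_ge0_le f df a b : continuous f -> a <= b ->
  (forall x, a < x -> x < b -> is_derive x 1 f (df x)) ->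
  (forall x, a < x -> x < b -> 0 <= df x) -> f a <= f b.
Proof.
move=> cf; rewrite le_eqVlt => /predU1P[->//|ab] fdf df0.
have fD x : x \in `]a, b[ -> is_derive x 1 f (df x).
  by rewrite in_itv/= => /andP[? ?]; exact: fdf.
have [c] := MVT ab fD (continuous_subspaceT cf).
rewrite in_itv/= => /andP[ac cb] fE.
by rewrite -subr_ge0 fE mulr_ge0 ?subr_ge0 ?df0 ?ltW.
Qed.

Lemma derive_gt0_lt f df a b : continuous f -> a < b ->
  (forall x, a < x -> x < b -> is_derive x 1 f (df x)) ->
  (forall x, a < x -> x < b -> 0 < df x) -> f a < f b.
Proof.
move=> cf ab fdf df0.
have fD x : x \in `]a, b[ -> is_derive x 1 f (df x).
  by rewrite in_itv/= => /andP[? ?]; exact: fdf.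
have [c] := MVT ab fD (continuous_subspaceT cf).
rewrite in_itv/= => /andP[ac cb] fE.
by rewrite -subr_gt0 fE mulr_gt0 ?subr_gt0 ?df0.
Qed.

Lemma derive_le f g df dg a b : continuous f -> continuous g -> a <= b ->
  (forall x, a < x -> x < b -> is_derive x 1 f (df x)) ->
  (forall x, a < x -> x < b -> is_derive x 1 g (dg x)) ->
  (forall x, a < x -> x < b -> df x <= dg x) -> f b - f a <= g b - g a.
Proof.
move=> cf cg ab fdf gdg dfg.
have : g a - f a <= g b - f b.
  apply: (@derive_ge0_le (fun x => g x - f x) (fun x => dg x - df x)) => //.
  - by cont.
  - by move=> x ax xb; der; [exact: gdg|exact: fdf].
  - by move=> x ax xb; rewrite subr_ge0 dfg.
by lra.
Qed.

Lemma derive0_eq f a b : continuous f -> a <= b ->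
  (forall x, a < x -> x < b -> is_derive x 1 f 0) -> f b = f a.
Proof.
move=> cf ab f0; apply/eqP; rewrite eq_le; apply/andP; split; last first.
  exact: (@derive_ge0_le _ (fun=> 0)).
rewrite -lerN2.
apply: (@derive_ge0_le (fun x => - f x) (fun=> 0)) => //.
  by cont.
by move=> x ax xb; rewrite -[0]oppr0; der; exact: f0.
Qed.

Lemma continuous_bounded f a b : continuous f -> exists2 M, 0 < M & forall x, a <= x <= b ->
  `|f x| <= M.
Proof.
move=> cf; have [ab|ba] := leP a b; last first.
  by exists 1 => // x /andP[ax xb]; move: (le_trans ax xb); rewrite leNgt ba.
have cnf : continuous (fun x => `|f x|) by cont.
have [c _ cmax] := EVT_max ab (continuous_subspaceT cnf).
exists (`|f c| + 1); first by rewrite ltr_wpDl.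
by move=> x xab; rewrite (le_trans (cmax x _)) ?in_itv// lerDl.
Qed.

(** One-sided Gronwall argument: after the last point s with d <= 0, d is positive, so d exp (-L x)
    decreases from a nonpositive value and cannot end positive. Restricting the inequality to d > 0
    makes the lemma fit comparison, invariance and uniqueness alike. *)
Lemma differential_barrier d (dd : R -> R) (L : R) a b : continuous d -> a <= b ->
  (forall x, a < x -> x < b -> is_derive x 1 d (dd x)) ->
  (forall x, a < x -> x < b -> 0 < d x -> dd x <= L * d x) ->
  d a <= 0 -> d b <= 0.
Proof.
move=> cd ab dD dL da; rewrite leNgt; apply/negP => db.
pose S := [set x | a <= x <= b /\ d x <= 0].
have S0 : S !=set0 by exists a; rewrite /S/= lexx ab da.
have Sub : has_ubound S by exists b => x [/andP[_ ]].
have hS : has_sup S by split.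
pose s := sup S.
have sb : s <= b by apply: ge_sup => // x [/andP[_ ]].
have as_ : a <= s by apply: sup_ubound => //; rewrite /S/= lexx ab da.
have cS : closed S.
  have -> : S = `[a, b] `&` [set x | d x <= 0].
    by apply/seteqP; split => x /=; rewrite in_itv.
  apply: closedI; first exact: itv_closed.
  apply: (@closed_comp _ _ d [set x | x <= 0]) => //; exact: closed_le.
have Ss : S s by apply: cS; apply: closure_sup.
have ds : d s <= 0 by case: Ss.
have pos x : s < x -> x <= b -> 0 < d x.
  move=> sx xb; rewrite ltNge; apply/negP => dx.
  have /(sup_ubound Sub) : S x by rewrite /S/= xb (le_trans as_ (ltW sx)).
  by rewrite leNgt sx.
pose e x := expR (- L * x).
have eD x : is_derive x 1 e (- L * e x).
  by rewrite /e; der_to; ring.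
have ce : continuous e by rewrite /e; cont.
have h : d b * e b <= d s * e s.
  rewrite -lerN2.
  apply: (@derive_ge0_le (fun x => - (d x * e x)) (fun x => - ((dd x - L * d x) * e x))) => //.
  - by cont.
  - move=> x sx xb; have xD := dD x (le_lt_trans as_ sx) xb.
    by have eDx := eD x; der_to; ring.
  - move=> x sx xb; rewrite oppr_ge0 mulr_le0_ge0 ?expR_ge0// subr_le0.
    by apply: dL => //; [exact: le_lt_trans sx|apply: pos => //; exact: ltW].
have : 0 < d b * e b by rewrite mulr_gt0// expR_gt0.
rewrite ltNge => /negP; apply; apply: le_trans h _.
by rewrite mulr_le0_ge0 ?expR_ge0.
Qed.

(* This vanishes for x <= 0: solutions below are continuous on the whole line but
   satisfy their equation for x > 0 only. *)
Definition antideriv f x : R := (\int[mu]_(t in `[0, x]) f t)%R.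

Lemma antideriv_le0 f x : x <= 0 -> antideriv f x = 0.
Proof.
rewrite /antideriv le_eqVlt => /predU1P[->|x0]; first by rewrite set_itv1 Rintegral_set1.
by rewrite set_itv_ge ?Rintegral_set0// bnd_simp -ltNge.
Qed.

Lemma continuous_integrable_itv f a b : continuous f -> mu.-integrable `[a, b] (EFin \o f).
Proof.
move=> cf; apply: continuous_compact_integrable; first exact: segment_compact.
exact: continuous_subspaceT.
Qed.

Lemma is_derive_antideriv f x : continuous f -> 0 < x -> is_derive x 1 (antideriv f) (f x).
Proof.
move=> cf x0.
have [] := @continuous_FTC1_closed _ f 0 x (x + 1) _ _ x0 (cf x).
- by rewrite ltrDl.
- exact: continuous_integrable_itv.
by move=> dA <-; rewrite derive1E; exact: derivableP.
Qed.

Lemma continuous_antideriv f : continuous f -> continuous (antideriv f).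
Proof.
move=> cf x; have [x0|x0|->] := ltgtP x 0.
- rewrite /continuous_at antideriv_le0; last exact: ltW.
  apply: cvg_near_cst; near=> y; apply: antideriv_le0; apply: ltW.
  by near: y; exact: lt_nbhsl.
- apply/differentiable_continuous/derivable1_diffP.
  by case: (is_derive_antideriv cf x0).
- rewrite /continuous_at antideriv_le0//.
  exact: (@parameterized_integral_cvg_left R 0 1 f ltr01 (continuous_integrable_itv _ _ cf)).
Unshelve. all: by end_near. Qed.

Lemma antideriv_eq f F x : continuous f -> continuous F -> 0 <= x ->
  (forall y, 0 < y -> y < x -> is_derive y 1 F (f y)) -> antideriv f x = F x - F 0.
Proof.
move=> cf cF x0 FD.
have cA := continuous_antideriv cf.
have A0 : antideriv f 0 = 0 by rewrite antideriv_le0.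
suff h : antideriv f x - F x = antideriv f 0 - F 0 by lra.
apply: (@derive0_eq (fun y => antideriv f y - F y)) => //; first by cont.
move=> y y0 yx; have Fy := FD y y0 yx; have Ay := is_derive_antideriv cf y0.
by der_to; ring.
Qed.

Lemma antideriv_ge0_le f x y : continuous f -> (forall z, 0 <= z -> 0 <= f z) -> 0 <= x -> x <= y ->
  antideriv f x <= antideriv f y.
Proof.
move=> cf f0 x0 xy; apply: (@derive_ge0_le _ f) => //; first exact: continuous_antideriv.
  by move=> z xz _; apply: is_derive_antideriv => //; exact: le_lt_trans xz.
by move=> z xz _; apply: f0; exact: le_trans x0 (ltW xz).
Qed.

End calculus.

Lemma antiderivE {R : realType} (f : R -> R) (x : R) :
  antideriv f x = (\int[@lebesgue_measure R]_(t in `[0, x]) f t)%R.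
Proof. by []. Qed.

(* Unification would otherwise unfold the integral. *)
Opaque antideriv.

(** * Scalar initial value problems *)

Section picard.
Context {R : realType}.

Lemma cvg_div_exp2 (K : R) : K / 2 ^+ n @[n --> \oo] --> 0.
Proof.
have -> : (fun n => K / 2 ^+ n) = geometric K (2^-1 : R).
  by apply/funext => n; rewrite /= exprVn.
by apply: cvg_geometric; rewrite ger0_norm; lra.
Qed.

Lemma le0_div_exp2 (a K : R) : (forall n, a <= K / 2 ^+ n) -> a <= 0.
Proof.
move=> h; have c := cvg_div_exp2 K.
rewrite -(cvg_lim _ c); last by exact: Rhausdorff.
apply: limr_ge; first by apply/cvg_ex; exists 0.
by near=> n; exact: h.
Unshelve. all: by end_near. Qed.

Lemma geometric_cauchy (u : nat -> R) (K : R) :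
  (forall n, `|u n.+1 - u n| <= K / 2 ^+ n) -> forall n, `|u n - limn u| <= 2 * K / 2 ^+ n.
Proof.
move=> uK.
have step n : K / 2 ^+ n = 2 * (K / 2 ^+ n.+1).
  by rewrite exprS invfM; field; rewrite expf_neq0.
have bnd n m : `|u (n + m)%N - u n| <= 2 * (K / 2 ^+ n) - 2 * (K / 2 ^+ (n + m)).
  elim: m => [|m IH]; first by rewrite addn0 !subrr normr0.
  rewrite addnS; have := uK (n + m)%N; have := step (n + m)%N.
  move: IH; set a := K / _; set b := K / _; set c := K / _.
  rewrite !ler_norml; lra.
have K0 : 0 <= K by have := uK 0%N; rewrite expr0 divr1; apply: le_trans.
(* Adding the tail of the geometric series makes the sequence nonincreasing, so it converges by
   monotonicity. *)
pose v n := u n + 2 * (K / 2 ^+ n).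
have v_dec : nonincreasing_seq v.
  apply/nonincreasing_seqP => n; rewrite /v.
  by have := uK n; have := step n; rewrite ler_norml; lra.
have lb : has_lbound (range v).
  exists (u 0%N - 2 * K) => _ [n _ <-]; rewrite /v.
  have := bnd 0%N n; rewrite add0n expr0 divr1 ler_norml.
  by have : 0 <= K / 2 ^+ n; [rewrite divr_ge0// exprn_ge0|lra].
have /cvg_ex[l vl] := nonincreasing_is_cvgn v_dec lb.
have ul : u n @[n --> \oo] --> l.
  rewrite (_ : u = (fun n => v n - 2 * K / 2 ^+ n)); last first.
    by apply/funext => n; rewrite /v; ring.
  rewrite -[l]subr0; apply: cvgB => //; exact: cvg_div_exp2.
move=> n; rewrite (cvg_lim _ ul); last exact: Rhausdorff.
have c : `|u n - u (n + m)%N| @[m --> \oo] --> `|u n - l|.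
  apply: cvg_norm; apply: cvgB; first exact: cvg_cst.
  by rewrite (_ : (fun m => u (n + m)%N) = (fun m => u (m + n)%N)) ?cvg_shiftn//;
    apply/funext => m; rewrite addnC.
rewrite -(cvg_lim _ c); last exact: Rhausdorff.
apply: limr_le; first by apply/cvg_ex; eexists; exact: c.
near=> m; rewrite distrC; apply: le_trans (bnd n m) _.
rewrite mulrA lerBlDr lerDl mulr_ge0// divr_ge0// exprn_ge0//.
Unshelve. all: by end_near. Qed.

Lemma norm_derive_le (f df g dg : R -> R) (a b : R) : continuous f -> continuous g -> a <= b ->
  (forall x, a < x -> x < b -> is_derive x 1 f (df x)) ->
  (forall x, a < x -> x < b -> is_derive x 1 g (dg x)) ->
  (forall x, a < x -> x < b -> `|df x| <= dg x) -> `|f b - f a| <= g b - g a.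
Proof.
move=> cf cg ab fD gD fg; rewrite ler_norml; apply/andP; split; last first.
  by apply: (derive_le cf cg ab fD gD) => x ax xb; apply: le_trans (fg x ax xb); rewrite ler_norm.
have cNg : continuous (fun x => - g x) by cont.
have := @derive_le _ (fun x => - g x) f (fun x => - dg x) df a b cNg cf ab _ fD.
move=> h.
have : - g b - - g a <= f b - f a.
  apply: h => x ax xb; first by have gx := gD x ax xb; der.
  by rewrite lerNl; apply: le_trans (fg x ax xb); rewrite -normrN ler_norm.
lra.
Qed.

Variables (F : R -> R -> R) (y0 : R).
Hypothesis cF : forall y : R -> R, continuous y -> continuous (fun x => F x (y x)).
Hypothesis lipF : forall X : R, exists2 L : R, 0 < L &
  forall x : R, 0 <= x <= X -> forall y z, `|F x y - F x z| <= L * `|y - z|.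

Let P (y : R -> R) (x : R) : R := y0 + antideriv (fun t => F t (y t)) x.
Let u n := iter n P (fun=> y0).

Let cP (y : R -> R) : continuous y -> continuous (P y).
Proof. by move=> cy; rewrite /P; have := continuous_antideriv (cF cy) => ?; cont. Qed.

Let cu n : continuous (u n).
Proof. by elim: n => [|n IH]; [rewrite /u/=; cont|exact: cP]. Qed.

Let P_le0 (y : R -> R) (x : R) : x <= 0 -> P y x = y0.
Proof. by move=> x0; rewrite /P antideriv_le0// addr0. Qed.

Let u_le0 n (x : R) : x <= 0 -> u n x = y0.
Proof. by case: n => // n; exact: P_le0. Qed.

Let PD (y : R -> R) (x : R) : continuous y -> 0 < x -> is_derive x 1 (P y) (F x (y x)).
Proof.
move=> cy x0; have h := is_derive_antideriv (cF cy) x0.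
by rewrite /P; der_to; ring.
Qed.

Let bound (X : R) : exists K : R, forall x : R, x <= X ->
  forall n, `|u n.+1 x - u n x| <= K / 2 ^+ n.
Proof.
have [L L0 lL] := lipF X.
have cd : continuous (fun x => u 1%N x - u 0%N x).
  by have := @cu 1%N; have := @cu 0%N; move=> ? ?; cont.
have [M M0 dM] := continuous_bounded 0 X cd.
(* Integrating L exp (2 L x) gives half of exp (2 L x): with this weight every iteration contracts
   by 1/2 on [0, X], however large X is. *)
have key n (x : R) : 0 <= x <= X -> `|u n.+1 x - u n x| <= M / 2 ^+ n * expR (2 * L * x).
  elim: n x => [|n IH] x x0X.
    rewrite expr0 divr1; apply: le_trans (dM x x0X) _.
    rewrite ler_peMr ?(ltW M0)// -expR0 ler_expR !mulr_ge0// ?(ltW L0)//.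
    by case/andP: x0X.
  have /andP[x0 xX] := x0X.
  have c1 := @cu n.+2; have c2 := @cu n.+1; have c3 := @cu n.
  have := @norm_derive_le (fun x => u n.+2 x - u n.+1 x)
    (fun x => F x (u n.+1 x) - F x (u n x))
    (fun x => M / 2 ^+ n.+1 * expR (2 * L * x))
    (fun x => L * (M / 2 ^+ n * expR (2 * L * x))) 0 x.
  have -> : u n.+2 0 - u n.+1 0 = 0 by rewrite !u_le0// subrr.
  rewrite subr0 => h; apply: le_trans (h _ _ x0 _ _ _) _.
  - by cont.
  - by cont.
  - move=> z z0 zx; have d1 : is_derive z 1 (u n.+2) (F z (u n.+1 z)) by exact: PD.
    have d2 : is_derive z 1 (u n.+1) (F z (u n z)) by exact: PD.
    by der.
  - move=> z z0 zx; der_to; rewrite exprS; field.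
    by rewrite expf_neq0.
  - move=> z z0 zx; have zX : 0 <= z <= X by rewrite (ltW z0) (le_trans (ltW zx)).
    by apply: le_trans (lL z zX _ _) _; rewrite ler_pM2l// IH.
  - by rewrite lerBlDr lerDl mulr_ge0// ?expR_ge0// divr_ge0 ?exprn_ge0// ltW.
exists (M * expR (2 * L * X)) => x xX n.
have KK : 0 <= M * expR (2 * L * X) / 2 ^+ n.
  by rewrite divr_ge0 ?exprn_ge0// mulr_ge0 ?expR_ge0// ltW.
have [x0|x0] := leP x 0; first by rewrite !u_le0// subrr normr0.
apply: le_trans (key n x _) _; first by rewrite (ltW x0).
rewrite mulrAC ler_pM2r ?invr_gt0 ?exprn_gt0//.
by rewrite ler_pM2l// ler_expR ler_pM2l// mulr_gt0.
Qed.

(* The iterates satisfy |u_(n+1) - u_n| <= M 2^-n exp(2 L x) on [0, X]. *)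
Lemma picard : exists y : R -> R, [/\ continuous y, y 0 = y0 &
  forall x : R, 0 < x -> is_derive x 1 y (F x (y x))].
Proof.
pose y (x : R) : R := limn (fun n => u n x).
have yK (X : R) : exists K : R, forall x : R, x <= X -> forall n, `|u n x - y x| <= 2 * K / 2 ^+ n.
  have [K hK] := bound X; exists K => x xX; apply: geometric_cauchy.
  exact: hK.
have cy : continuous y.
  move=> x; have [K hK] := yK (x + 1).
  apply/cvgrPdist_le => /= e e0.
  have [n hn] : exists n, 2 * K / 2 ^+ n <= e / 3.
    have /cvgrPdist_le/(_ (e/3)) := cvg_div_exp2 (2 * K).
    rewrite divr_gt0// => /(_ isT)[n _ /(_ n (leqnn n))]/=.
    by rewrite sub0r normrN => h; exists n; apply: le_trans (ler_norm _) h.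
  near=> z.
  have zx : z <= x + 1 by apply: ltW; near: z; apply: lt_nbhsl; rewrite ltrDl.
  have uzx : `|u n x - u n z| <= e / 3.
    near: z; have /cvgrPdist_le := @cu n x.
    by apply; rewrite divr_gt0.
  have h1 := le_trans (hK z zx n) hn.
  have h2 := le_trans (hK x _ n) hn.
  have : `|u n x - y x| <= e / 3 by apply: h2; rewrite lerDl.
  by move: h1 uzx; rewrite !ler_norml => /andP[? ?] /andP[? ?] /andP[? ?]; lra.
have y_le0 (x : R) : x <= 0 -> y x = y0.
  move=> x0; rewrite /y (_ : (fun n => u n x) = fun=> y0); first exact: lim_cst.
  by apply/funext => n; rewrite u_le0.
have yE : P y = y.
  apply/funext => x; have [x0|x0] := leP x 0; first by rewrite P_le0// y_le0.
  have [K hK] := yK x; have [L L0 lL] := lipF x.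
  apply/eqP; rewrite -subr_eq0 -normr_le0.
  (* The first summand bounds the distance from [P y] to [u n.+1], by the Lipschitz bound on F; the
     second bounds that from [u n.+1] to y. *)
  apply: (@le0_div_exp2 _ (2 * L * K * x + K)) => n.
  have : `|P y x - u n.+1 x| <= 2 * L * K / 2 ^+ n * x.
    have cPy := cP cy; have cun := @cu n.+1.
    have := @norm_derive_le (fun x => P y x - u n.+1 x) (fun x => F x (y x) - F x (u n x))
      (fun x => 2 * L * K / 2 ^+ n * x) (fun=> 2 * L * K / 2 ^+ n) 0 x.
    have -> : P y 0 - u n.+1 0 = 0 by rewrite P_le0// u_le0// subrr.
    rewrite mulr0 !subr0; apply => //; try by cont.
    - exact: ltW.
    - move=> z z0 zx; have d1 := PD cy z0; have d2 := PD (@cu n) z0.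
      by der; exact: d2.
    - by move=> z z0 zx; der_to; ring.
    - move=> z z0 zx; apply: le_trans (lL z _ _ _) _; first by rewrite !ltW.
      rewrite distrC; have -> : 2 * L * K / 2 ^+ n = L * (2 * K / 2 ^+ n) by ring.
      by rewrite ler_pM2l// hK// ltW.
  have := hK x (lexx x) n.+1.
  have -> : 2 * K / 2 ^+ n.+1 = K / 2 ^+ n by rewrite exprS; field; rewrite expf_neq0.
  rewrite (_ : (2 * L * K * x + K) / 2 ^+ n = 2 * L * K / 2 ^+ n * x + K / 2 ^+ n); last by ring.
  by rewrite !ler_norml; lra.
exists y; split=> //; first exact: y_le0.
by move=> x x0; rewrite -{1}yE; exact: PD.
Unshelve. all: by end_near. Qed.

End picard.

(** * The Pruefer angle *)

Section trig.
Context {R : realType}.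
Implicit Types a b x y : R.

(** A shift by pi flips both factors, so such products are pi-periodic and the sign lemmas below
    reduce to n = 0. *)
Lemma sin_cos_npi_mul n a :
  sin (n%:R * pi + a) * cos (n%:R * pi + a) = sin a * cos a.
Proof.
elim: n a => [|n IH] a; first by rewrite mul0r add0r.
rewrite (_ : n.+1%:R * pi + a = n%:R * pi + a + pi); last by rewrite -natr1; ring.
by rewrite sinDpi cosDpi mulrNN IH.
Qed.

Lemma sin_sin_npi_mul n a b :
  sin (n%:R * pi + a) * sin (n%:R * pi + b) = sin a * sin b.
Proof.
elim: n a => [|n IH] a; first by rewrite !mul0r !add0r.
rewrite (_ : n.+1%:R * pi + a = n%:R * pi + a + pi); last by rewrite -natr1; ring.
rewrite (_ : n.+1%:R * pi + b = n%:R * pi + b + pi); last by rewrite -natr1; ring.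
by rewrite !sinDpi mulrNN IH.
Qed.

Lemma sin_npi n : sin (n%:R * pi : R) = 0.
Proof.
elim: n => [|n IH]; first by rewrite mul0r sin0.
by rewrite -natr1 mulrDl mul1r sinDpi IH oppr0.
Qed.

Lemma cos_npi_pihalf n : cos (n%:R * pi + pi / 2 : R) = 0.
Proof. by rewrite cosDpihalf sin_npi oppr0. Qed.

Lemma sin_cos_gt0 n a : n%:R * pi < a -> a < n%:R * pi + pi / 2 -> 0 < sin a * cos a.
Proof.
move=> h1 h2; rewrite (_ : a = n%:R * pi + (a - n%:R * pi)); last by ring.
have p0 := @pi_gt0 R.
rewrite sin_cos_npi_mul mulr_gt0//.
- by apply: sin_gt0_pi; apply/andP; split; lra.
- by apply: cos_gt0_pihalf; apply/andP; split; lra.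
Qed.

Lemma sin_cos_le0 n a : n%:R * pi + pi / 2 <= a -> a <= n.+1%:R * pi -> sin a * cos a <= 0.
Proof.
move=> h1; rewrite -[n.+1%:R]natr1 mulrDl mul1r => h2;
  rewrite (_ : a = n%:R * pi + (a - n%:R * pi)); last by ring.
have p0 := @pi_gt0 R.
rewrite sin_cos_npi_mul mulr_ge0_le0//.
- by apply: sin_ge0_pi; apply/andP; split; lra.
- rewrite -[_ - _](subrK pi) cosDpi oppr_le0.
  by apply: cos_ge0_pihalf; apply/andP; split; lra.
Qed.

Lemma sin_sin_gt0 n a b : n%:R * pi < a -> a < n.+1%:R * pi ->
  n%:R * pi < b -> b < n.+1%:R * pi -> 0 < sin a * sin b.
Proof.
rewrite -[n.+1%:R]natr1 mulrDl mul1r => a1 a2 b1 b2.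
rewrite (_ : a = n%:R * pi + (a - n%:R * pi)); last by ring.
rewrite (_ : b = n%:R * pi + (b - n%:R * pi)); last by ring.
by rewrite sin_sin_npi_mul mulr_gt0//; apply: sin_gt0_pi; apply/andP; split; lra.
Qed.

Lemma lipschitz_of_derive (f df : R -> R) (L : R) :
  (forall x, is_derive x 1 f (df x)) -> (forall x, `|df x| <= L) ->
  forall y z, `|f y - f z| <= L * `|y - z|.
Proof.
move=> fD fL y z; wlog zy : y z / z <= y.
  move=> h; have [|/ltW yz] := leP z y; first exact: h.
  by rewrite distrC (distrC y); exact: h.
have cf : continuous f.
  by move=> x; apply/differentiable_continuous/derivable1_diffP; case: (fD x).
rewrite (ger0_norm (_ : 0 <= y - z)) ?subr_ge0// mulrBr.
apply: (@norm_derive_le _ f df (fun x => L * x) (fun=> L)) => //; first by cont.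
by move=> x _ _; der_to; ring.
Qed.

Lemma sin2Dcos2 x : sin x ^+ 2 + cos x ^+ 2 = 1.
Proof. by rewrite addrC cos2Dsin2. Qed.
End trig.

Lemma cont_inv {R : realType} (f : R -> R) : (forall x, f x != 0) -> continuous f ->
  continuous (fun x => (f x)^-1).
Proof. by move=> f0 cf x; apply: continuousV; [exact: f0|exact: cf]. Qed.

Lemma cont_atan {R : realType} (f : R -> R) : continuous f -> continuous (fun x => atan (f x)).
Proof. by move=> cf; apply: (@contcomp _ atan) => //; exact: continuous_atan. Qed.

(* The local wave number sqrt (lam - x), frozen at its value 1 beyond x = lam - 1. *)
Lemma wave_number_exists {R : realType} (lam : R) : 1 <= lam -> exists k : R -> R,
  [/\ continuous k, forall x, 1 <= k x,
      forall x, x < lam - 1 -> k x ^+ 2 = lam - x /\ is_derive x 1 k (- (2 * k x)^-1),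
      k 0 = Num.sqrt lam & k (lam - 1) = 1].
Proof.
move=> lam1; pose h (x : R) : R := lam - x.
have ch : continuous h by rewrite /h; cont.
pose k (x : R) : R := Num.sqrt (Num.max (lam - x) 1).
have ck : continuous k.
  apply: (@contcomp _ Num.sqrt); first exact: sqrt_continuous.
  move=> x; apply: (@continuous_max _ _ h (cst 1)); first exact: ch.
  exact: cst_continuous.
have kE x : x < lam - 1 -> k x = Num.sqrt (lam - x).
  by move=> xl; rewrite /k max_l//; lra.
exists k; split => //.
- move=> x; rewrite -sqrtr1 /k ler_wsqrtr// le_max lexx orbT//.
- move=> x xl; rewrite kE//; split; first by rewrite sqr_sqrtr//; lra.
  have lx : 0 < lam - x by lra.
  apply: (@near_eq_is_derive _ _ _ (fun x => Num.sqrt (lam - x))).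
  - near=> y; rewrite kE//; near: y; exact: lt_nbhsl.
  - have s := is_derive1_sqrt lx.
    have d : is_derive x 1 h (- 1) by rewrite /h; der_to; ring.
    by refine (der_eq (@der_comp _ Num.sqrt h x _ _ s d) _); ring.
- rewrite /k subr0 max_l//.
- by rewrite /k opprB addrC subrK maxxx sqrtr1.
Unshelve. all: by end_near. Qed.

(** * The angle of the rescaled pair, corrected for its oscillation *)

Section modified_angle.
Context {R : realType}.
Implicit Types s c k : R.

Let den s c k : R := c ^+ 2 + k ^+ 2 * s ^+ 2.

(* [y + atan (..)] is the angle of the rescaled pair (k u, w); the last summand
   removes the oscillating term k'/k sin cos of its derivative. *)
Definition modified_angle (k y : R) : R :=
  y + atan ((k - 1) * (sin y * cos y) * (cos y ^+ 2 + k * sin y ^+ 2)^-1)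
    - (2 * cos y ^+ 2 * (cos y ^+ 2 + k ^+ 2 * sin y ^+ 2)^-1 - 1) * (8 * k ^+ 3)^-1.

(** [den] is the squared length of (k s, c); the two mixed bounds expand (c - k s)^2 >= 0 and (c + k
    s)^2 >= 0. *)
Let den_ge s c k : s ^+ 2 + c ^+ 2 = 1 -> 1 <= k ->
  [/\ 1 <= c ^+ 2 + k * s ^+ 2, 1 <= den s c k, k * s ^+ 2 <= den s c k,
      2 * k * (s * c) <= den s c k & - (2 * k * (s * c)) <= den s c k].
Proof.
move=> sc k1; have s2 := sqr_ge0 s; have c2 := sqr_ge0 c.
have h1 : s ^+ 2 <= k * s ^+ 2 by rewrite ler_peMl.
have h2 : k * s ^+ 2 <= k ^+ 2 * s ^+ 2 by rewrite expr2 -mulrA ler_peMl// mulr_ge0//; lra.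
split; rewrite /den; try lra.
- have := sqr_ge0 (c - k * s); lra.
- have := sqr_ge0 (c + k * s); lra.
Qed.

(** The quantity is the cosine of twice the angle of (k s, c). *)
Let J_bound s c k : s ^+ 2 + c ^+ 2 = 1 -> 1 <= k -> `|2 * c ^+ 2 * (den s c k)^-1 - 1| <= 1.
Proof.
move=> sc k1; have [_ D1 _ _ _] := den_ge sc k1.
have D0 : 0 < den s c k by lra.
have : 0 <= c ^+ 2 * (den s c k)^-1 by rewrite mulr_ge0 ?sqr_ge0// invr_ge0 ltW.
have : c ^+ 2 * (den s c k)^-1 <= 1.
  by rewrite ler_pdivrMr// mul1r /den lerDl mulr_ge0 ?sqr_ge0.
by rewrite ler_norml; lra.
Qed.

(** The tangent of the difference of the two angles has the positive denominator c^2 + k s^2, so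
    [atan] is the right branch everywhere. It contributes less than pi/2, and the correction at most
    1 <= pi/2. *)
Lemma modified_angle_close (k y : R) : 1 <= k -> `|modified_angle k y - y| <= pi.
Proof.
move=> k1; have := J_bound (sin2Dcos2 y) k1; rewrite /modified_angle /den.
set J := _ - 1; set a := (X in atan X) => HJ.
have k0 : 0 < k by lra.
have i0 : 0 < (8 * k ^+ 3)^-1 by rewrite invr_gt0 mulr_gt0// exprn_gt0.
have i1 : (8 * k ^+ 3)^-1 <= 1.
  rewrite invf_le1 ?mulr_gt0 ?exprn_gt0//.
  by have : 1 <= k ^+ 3; [rewrite exprn_ege1|lra].
have : `|J * (8 * k ^+ 3)^-1| <= 1.
  rewrite normrM (gtr0_norm i0); apply: mulr_ile1 => //; exact: ltW.
have := atan_gtNpi2 a; have := atan_ltpi2 a; have := @pi_ge2 R.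
by rewrite !ler_norml; lra.
Qed.

Lemma continuous_modified_angle (k y : R -> R) : continuous k -> continuous y ->
  (forall x, 1 <= k x) -> continuous (fun x => modified_angle (k x) (y x)).
Proof.
move=> ck cy k1; rewrite /modified_angle.
have c1 : continuous (fun x => (cos (y x) ^+ 2 + k x * sin (y x) ^+ 2)^-1).
  apply: (@cont_inv _ (fun x => cos (y x) ^+ 2 + k x * sin (y x) ^+ 2)); last by cont.
  move=> x; have [h _ _ _ _] := den_ge (sin2Dcos2 (y x)) (k1 x); apply: lt0r_neq0; lra.
have c2 : continuous (fun x => (cos (y x) ^+ 2 + k x ^+ 2 * sin (y x) ^+ 2)^-1).
  apply: (@cont_inv _ (fun x => cos (y x) ^+ 2 + k x ^+ 2 * sin (y x) ^+ 2)); last by cont.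
  move=> x; have [_ h _ _ _] := den_ge (sin2Dcos2 (y x)) (k1 x); apply: lt0r_neq0.
  rewrite /den in h; lra.
have c3 : continuous (fun x => (8 * k x ^+ 3)^-1).
  apply: (@cont_inv _ (fun x => 8 * k x ^+ 3)); last by cont.
  by move=> x; have := k1 x => k1x; rewrite mulf_neq0// expf_neq0// lt0r_neq0//; lra.
have c4 : continuous (fun x => atan ((k x - 1) * (sin (y x) * cos (y x)) *
    (cos (y x) ^+ 2 + k x * sin (y x) ^+ 2)^-1)) by apply: cont_atan; cont.
by cont.
Qed.

(** Write eta for the angle of (k s, c), so that k s c / D = sin eta cos eta and J = cos (2 eta).
    Then eta' = k - (sin eta cos eta)/(2 k^2) + [q1]. Differentiating -J/(8 k^3) cancels the middle
    term; the defect is what remains, with the k^-5 terms coming from k' = -1/(2 k). *)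
Let defect s c k Q p : R :=
  let D := c ^+ 2 + k ^+ 2 * s ^+ 2 in
  let J := 2 * c ^+ 2 * D^-1 - 1 in
  let q1 := 2 * Q * (k * (s * c) / D) - p * (k * s ^+ 2 / D) in
  q1 + k^-1 ^+ 3 / 2 * (k * (s * c) / D) * q1
      - k^-1 ^+ 5 / 4 * (k * (s * c) / D) ^+ 2 - 3 / 16 * k^-1 ^+ 5 * J.

(** The left-hand side has the shape that the differentiation rules produce. The relation s^2 + c^2
    = 1 enters by multiplying a term with s^2 + c^2, after which both sides agree as rational
    functions. *)
Let modified_angle_derivE s c k Q p : s ^+ 2 + c ^+ 2 = 1 -> k != 0 ->
  c ^+ 2 + k * s ^+ 2 != 0 -> c ^+ 2 + k ^+ 2 * s ^+ 2 != 0 ->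
  let D := c ^+ 2 + k ^+ 2 * s ^+ 2 in let E := c ^+ 2 + k * s ^+ 2 in
  let dk := - (2 * k)^-1 in
  let dy := c ^+ 2 + 2 * Q * (s * c) + (k ^+ 2 - p) * s ^+ 2 in
  let N := (k - 1) * (s * c) in
  let dN := dk * (s * c) + (k - 1) * (c * dy * c + s * (- s * dy)) in
  let dE := 2 * c * (- s * dy) + (dk * s ^+ 2 + k * (2 * s * (c * dy))) in
  let dD := 2 * c * (- s * dy) + (2 * k * dk * s ^+ 2 + k ^+ 2 * (2 * s * (c * dy))) in
  let J := 2 * c ^+ 2 * D^-1 - 1 in
  let dJ := 2 * (2 * c * (- s * dy)) * D^-1 + 2 * c ^+ 2 * (- dD / D ^+ 2) in
  dy + (1 + (N * E^-1) ^+ 2)^-1 * (dN * E^-1 + N * (- dE / E ^+ 2))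
     - (dJ * (8 * k ^+ 3)^-1 + J * (- (8 * (3 * k ^+ 2 * dk)) / (8 * k ^+ 3) ^+ 2))
  = k + defect s c k Q p.
Proof.
move=> sc k0 E0 D0 D E dk dy N dN dE dD J dJ.
have {}E0 : E != 0 := E0.
have {}D0 : D != 0 := D0.
(* This turns the derivative of atan (N / E) into (N' E - N E') / D, with the same denominator as
   J. *)
have EN : E ^+ 2 + N ^+ 2 = D.
  by transitivity ((s ^+ 2 + c ^+ 2) * D); [rewrite /E /N /D; ring|rewrite sc mul1r].
have A : (1 + (N * E^-1) ^+ 2)^-1 * (dN * E^-1 + N * (- dE / E ^+ 2)) =
    ((k - 1) * (c ^+ 2 - k * s ^+ 2) * dy + dk * (s * c)) / D.
  have -> : (k - 1) * (c ^+ 2 - k * s ^+ 2) * dy + dk * (s * c) = dN * E - N * dE.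
    transitivity ((s ^+ 2 + c ^+ 2) * ((k - 1) * (c ^+ 2 - k * s ^+ 2) * dy + dk * (s * c))).
      by rewrite sc mul1r.
    by rewrite /dN /dE /N /E; move: (dy) (dk) => y' k'; ring.
  rewrite -EN; have : E ^+ 2 + N ^+ 2 != 0 by rewrite EN.
  by move: (N) (dN) (dE) (E) E0 => n dn de e e0 en0; field; rewrite e0 en0.
have B : dJ = (2 * (s * c) ^+ 2 - 4 * (s * c) * k ^+ 2 * dy) / D ^+ 2.
  have -> : 2 * (s * c) ^+ 2 - 4 * (s * c) * k ^+ 2 * dy =
      2 * (s * c) ^+ 2 - 4 * (s * c) * (D - c ^+ 2 + k ^+ 2 * c ^+ 2) * dy.
    congr (_ - _ * _ * dy).
    by transitivity ((s ^+ 2 + c ^+ 2) * k ^+ 2); [rewrite sc mul1r|rewrite /D; ring].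
  rewrite /dJ /dD /dk /D; move: (dy) => y'.
  by field; rewrite exprMn k0 andbT; exact: D0.
have C : dy + (k - 1) * (c ^+ 2 - k * s ^+ 2) * dy / D = k * dy / D.
  have -> : k * dy / D = k * (s ^+ 2 + c ^+ 2) * dy / D by rewrite sc mulr1.
  by rewrite /D; move: (dy) => y'; field; rewrite ?exprMn; exact: D0.
have dyE : dy = D + 2 * Q * (s * c) - p * s ^+ 2 by rewrite /dy /D; ring.
have -> : dy + (1 + (N * E^-1) ^+ 2)^-1 * (dN * E^-1 + N * (- dE / E ^+ 2)) =
    k * dy / D + dk * (s * c) / D by rewrite A mulrDl addrA C.
rewrite B dyE /defect -/D -/J /dk; move: (J) (D) D0 (s * c) (s ^+ 2) => j d d0 T S.
by field; rewrite k0 d0.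
Qed.

(** The factor 4 is 2 for [q1] plus a crude 2 for its product with k^-3; the factor 1/4 is 1/16 +
    3/16, from t^2 <= 1/4 and |J| <= 1. *)
Lemma is_derive_modified_angle (k y : R -> R) (x Q p : R) : 1 <= k x ->
  is_derive x 1 k (- (2 * k x)^-1) ->
  is_derive x 1 y (cos (y x) ^+ 2 + 2 * Q * (sin (y x) * cos (y x)) +
     (k x ^+ 2 - p) * sin (y x) ^+ 2) ->
  exists2 d, is_derive x 1 (fun x => modified_angle (k x) (y x)) d &
    `|d - k x| <= 4 * Num.max `|Q| `|p| + 4^-1 * (k x)^-1 ^+ 5.
Proof.
move=> k1 kD yD.
have sc := sin2Dcos2 (y x); have [E1 D1 Ds Dp Dm] := den_ge sc k1.
have Jb := J_bound sc k1.
have E0 : cos (y x) ^+ 2 + k x * sin (y x) ^+ 2 != 0 by apply: lt0r_neq0; lra.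
have D0 : cos (y x) ^+ 2 + k x ^+ 2 * sin (y x) ^+ 2 != 0.
  by apply: lt0r_neq0; rewrite /den in D1; lra.
have k30 : 8 * k x ^+ 3 != 0 by rewrite mulf_neq0// expf_neq0// lt0r_neq0//; lra.
have k0 : k x != 0 by apply: lt0r_neq0; lra.
exists (k x + defect (sin (y x)) (cos (y x)) (k x) Q p).
  rewrite /modified_angle; der_to => //.
  rewrite -(modified_angle_derivE Q p sc k0 E0 D0).
  congr (_ + _ * (_ * _ + _ * (- _ / _)) - (_ * _ + _ * (- _ / _))) => /=; try ring.
rewrite addrAC subrr add0r /defect.
move: sc D1 Ds Dp Dm Jb; rewrite /den; have {E1 E0 k30 yD kD} := k1.
move: (sin (y x)) (cos (y x)) (k x) k0 D0 => s c kx kx0 D0 kx1 sc.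
move: (_ + _) D0 => D D0 D1 Ds Dp Dm Jb.
have kx_gt0 : 0 < kx by lra.
have D_gt0 : 0 < D by lra.
set J := _ - 1 in Jb *; set t := kx * (s * c) / D; set sg := kx * s ^+ 2 / D.
have tb : `|t| <= 2^-1.
  rewrite /t normrM normfV (gtr0_norm D_gt0) ler_pdivrMr// ler_norml; apply/andP; split; lra.
have sg0 : 0 <= sg.
  by apply: divr_ge0; [rewrite mulr_ge0 ?sqr_ge0// ltW|exact: ltW].
have sg1 : sg <= 1 by rewrite /sg ler_pdivrMr// mul1r.
have ki0 : 0 <= kx^-1 by rewrite invr_ge0 ltW.
have ki1 : kx^-1 <= 1 by rewrite invf_le1.
set m := Num.max _ _.
have Qm : `|Q| <= m by rewrite le_max lexx.
have pm : `|p| <= m by rewrite le_max lexx orbT.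
have m0 : 0 <= m by exact: le_trans Qm.
set q1 := 2 * Q * t - p * sg.
have q1m : `|q1| <= 2 * m.
  have h1 : `|2 * Q * t| <= m.
    rewrite (_ : 2 * Q * t = Q * (2 * t)); last by ring.
    rewrite normrM -[leRHS]mulr1 ler_pM// normrM gtr0_norm//; lra.
  have h2 : `|p * sg| <= m.
    by rewrite normrM -[leRHS]mulr1 ler_pM// ger0_norm.
  by apply: le_trans (ler_normB _ _) _; lra.
have h3 : `|kx^-1 ^+ 3 / 2 * t * q1| <= 2 * m.
  have k3 : kx^-1 ^+ 3 <= 1 by rewrite exprn_ile1.
  have k30 : 0 <= kx^-1 ^+ 3 by rewrite exprn_ge0.
  rewrite normrM -[leRHS]mul1r ler_pM// normrM mulr_ile1//; last by lra.
  by rewrite ger0_norm; lra.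
have k5 : 0 <= kx^-1 ^+ 5 by rewrite exprn_ge0.
have h4 : kx^-1 ^+ 5 / 4 * t ^+ 2 <= kx^-1 ^+ 5 / 16.
  have : t ^+ 2 <= 2^-1 ^+ 2 by rewrite -real_normK ?num_real// lerXn2r ?nnegrE//; lra.
  nra.
have h5 : 0 <= kx^-1 ^+ 5 / 4 * t ^+ 2 by rewrite mulr_ge0 ?sqr_ge0//; lra.
have h6 : `|3 / 16 * kx^-1 ^+ 5 * J| <= 3 / 16 * kx^-1 ^+ 5.
  rewrite normrM -[leRHS]mulr1 ler_pM// ger0_norm//; lra.
rewrite -/q1; move: q1m h3 h4 h5 h6; rewrite !ler_norml; lra.
Qed.

End modified_angle.

(** * The angle equation: monotonicity and barriers *)

Section angle.
Context {R : realType} (Q p : R -> R) (M : R).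
Hypotheses (cQ : continuous Q) (cp : continuous p).
Hypotheses (QM : forall x, 0 <= x -> `|Q x| <= M)
  (pM : forall x, 0 <= x -> `|p x| <= M).

(** This is (u' w - u w') / (u^2 + w^2) for u' = Q u + w, w' = (x - lam + p) u - Q w, with u = A sin
    y and w = A cos y. Hence zeros of u are multiples of pi. *)
Definition angle_rhs (lam x y : R) : R :=
  cos y ^+ 2 + 2 * Q x * (sin y * cos y) + (lam - x - p x) * sin y ^+ 2.

Let M0 : 0 <= M. Proof. exact: le_trans (QM (lexx 0)). Qed.

(** Uniformity over bounded [lam] serves the continuity in the parameter, where L >= 1 also lets L
    absorb the direct effect of changing [lam]. *)
Lemma angle_rhs_lipschitz (X Lam : R) : exists2 L : R, 1 <= L &
  forall lam x : R, `|lam| <= Lam -> 0 <= x <= X -> forall y z : R,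
  `|angle_rhs lam x y - angle_rhs lam x z| <= L * `|y - z|.
Proof.
pose L := 1 + 2 * M + (`|Lam| + `|X| + M).
have L1 : 1 <= L.
  by rewrite /L -!addrA lerDl !addr_ge0// mulr_ge0.
exists L => // lam x lamL /andP[x0 xX]; apply: (@lipschitz_of_derive _ _
  (fun y => - 2 * (sin y * cos y) + 2 * Q x * (cos y ^+ 2 - sin y ^+ 2)
            + 2 * (lam - x - p x) * (sin y * cos y))).
  by move=> y; rewrite /angle_rhs; der_to; rewrite /=; ring.
move=> y; have sc1 := sin2Dcos2 y.
set s := sin y in sc1 *; set c := cos y in sc1 *.
have [sD sB] : 0 <= (s + c) ^+ 2 /\ 0 <= (s - c) ^+ 2 by rewrite !sqr_ge0.
have [s0 c0] : 0 <= s ^+ 2 /\ 0 <= c ^+ 2 by rewrite !sqr_ge0.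
have sc : `|2 * (s * c)| <= 1 by rewrite ler_norml; apply/andP; split; lra.
have s2c2 : `|c ^+ 2 - s ^+ 2| <= 1 by rewrite ler_norml; apply/andP; split; lra.
have V : `|lam - x - p x| <= `|Lam| + `|X| + M.
  apply: le_trans (ler_normB _ _) _; apply: lerD; last exact: pM.
  apply: le_trans (ler_normB _ _) _; apply: lerD.
    by apply: le_trans lamL _; exact: ler_norm.
  by rewrite ger0_norm// (le_trans xX)// ler_norm.
apply: le_trans (ler_normD _ _) _; rewrite /L; apply: lerD; last first.
  rewrite (_ : 2 * (lam - x - p x) * (s * c) = (lam - x - p x) * (2 * (s * c))); last by ring.
  by rewrite normrM -[leRHS]mulr1 ler_pM.
apply: le_trans (ler_normD _ _) _; apply: lerD.
  by rewrite mulNr normrN.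
rewrite normrM -[leRHS]mulr1 ler_pM// normrM ger0_norm// ler_pM2l//.
exact: QM.
Qed.

Lemma angle_exists (t0 lam : R) : exists th : R -> R, [/\ continuous th, th 0 = t0 &
  forall x : R, 0 < x -> is_derive x 1 th (angle_rhs lam x (th x))].
Proof.
apply: picard.
  by move=> y cy; rewrite /angle_rhs; cont.
move=> X; have [L L1 h] := angle_rhs_lipschitz X `|lam|.
by exists L; [exact: lt_le_trans L1|move=> x xX y z; exact: h].
Qed.

Variables (t0 : R) (th : R -> R -> R).
Hypotheses (t0_ge0 : 0 <= t0) (cth : forall lam, continuous (th lam))
  (th0 : forall lam, th lam 0 = t0)
  (thD : forall lam x : R, 0 < x -> is_derive x 1 (th lam) (angle_rhs lam x (th lam x))).

Lemma angle_mono (lam mu x : R) : lam <= mu -> 0 <= x -> th lam x <= th mu x.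
Proof.
move=> lm x0; have [L L1 hL] := angle_rhs_lipschitz x `|lam|.
have ct1 := @cth lam; have ct2 := @cth mu.
rewrite -subr_le0; apply: (@differential_barrier _ (fun x => th lam x - th mu x)
  (fun x => angle_rhs lam x (th lam x) - angle_rhs mu x (th mu x)) L 0 x) => //.
- by cont.
- by move=> y y0 yx; have h1 := thD lam y0; have h2 := thD mu y0; der.
- move=> y y0 yx dy.
  have h := hL lam y (lexx _) _ (th lam y) (th mu y).
  have {}h := le_trans (ler_norm _) (h _).
  rewrite (ger0_norm (ltW dy)) in h.
  apply: le_trans (h _); last by rewrite (ltW y0) ltW.
  rewrite lerD2l lerN2 /angle_rhs lerD2l.
  by rewrite ler_wpM2r ?sqr_ge0//; lra.
- by rewrite !th0 subrr.
Qed.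

(** The parameter enters the equation through lam sin^2, so changing it costs at most mu - lam per
    unit of x. The comparison function (mu - lam) (exp (L x) - 1) solves d' = L d + L (mu - lam). *)
Lemma angle_continuous_param (X Lam : R) : exists2 K : R, 0 < K & forall lam mu : R,
  `|lam| <= Lam -> lam <= mu -> 0 <= X -> th mu X - th lam X <= (mu - lam) * K.
Proof.
have [L L1 hL] := angle_rhs_lipschitz X Lam.
exists (expR (L * X)); first exact: expR_gt0.
move=> lam mu lL lm X0.
have ct1 := @cth lam; have ct2 := @cth mu.
have : th mu X - th lam X - (mu - lam) * (expR (L * X) - 1) <= 0.
  apply: (@differential_barrier _ (fun x => th mu x - th lam x - (mu - lam) * (expR (L * x) - 1))
  (fun x => angle_rhs mu x (th mu x) - angle_rhs lam x (th lam x) -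
    (mu - lam) * (L * expR (L * x))) L 0 X) => //.
  - by cont.
  - by move=> y y0 yx; have h1 := thD lam y0; have h2 := thD mu y0; der_to; ring.
  - move=> y y0 yx _.
    have h := hL lam y lL _ (th mu y) (th lam y).
    have {}h := le_trans (ler_norm _) (h _).
    rewrite ger0_norm in h; last by rewrite subr_ge0; apply: angle_mono => //; exact: ltW.
    have {}h : angle_rhs lam y (th mu y) - angle_rhs lam y (th lam y) <=
      L * (th mu y - th lam y) by apply: h; rewrite (ltW y0) ltW.
    have : angle_rhs mu y (th mu y) - angle_rhs lam y (th mu y) <= mu - lam.
      rewrite /angle_rhs; have := sin2Dcos2 (th mu y); nra.
    have : mu - lam <= (mu - lam) * L by rewrite ler_peMr// subr_ge0.
    nra.
  - by rewrite !th0 mulr0 expR0 !subrr mulr0.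
have : 0 <= mu - lam by rewrite subr_ge0.
nra.
Qed.

Lemma angle_npi_le n (lam x y : R) : 0 <= x -> x <= y -> n%:R * pi <= th lam x ->
  n%:R * pi <= th lam y.
Proof.
move=> x0 xy; have [L L1 hL] := angle_rhs_lipschitz y `|lam|.
have ct := @cth lam.
rewrite -(subr_le0 (th lam x)) -(subr_le0 (th lam y)); apply: (@differential_barrier _
  (fun x => n%:R * pi - th lam x)
  (fun x => - angle_rhs lam x (th lam x)) L) => //.
- by cont.
- move=> z xz zy; have h := thD lam (le_lt_trans x0 xz); der_to; ring.
- move=> z xz zy dz.
  have := hL lam z (lexx _) _ (n%:R * pi) (th lam z).
  rewrite (ltW (le_lt_trans x0 xz)) (ltW zy) (ger0_norm (ltW dz)) => /(_ isT).
  move=> /(le_trans (ler_norm _)).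
  (* Where u vanishes the slope is 1 whatever Q and p are. *)
  have -> : angle_rhs lam z (n%:R * pi) = 1.
    by rewrite /angle_rhs cos2sin2 sin_npi expr0n /= mul0r !mulr0 subr0 !addr0.
  lra.
Qed.

(** Equality at y would make y an interior minimum, by the weak barrier, against the slope 1
    there. *)
Lemma angle_npi_lt n (lam x y : R) : 0 <= x -> x < y -> n%:R * pi <= th lam x ->
  n%:R * pi < th lam y.
Proof.
move=> x0 xy nx; rewrite lt_neqAle (angle_npi_le x0 (ltW xy) nx) andbT; apply/eqP => ny.
have y0 := le_lt_trans x0 xy.
have D : is_derive y 1 (th lam) 0.
  apply: (@derive1_at_min _ (th lam) x (y + 1)); first by lra.
  - move=> t; rewrite in_itv/= => /andP[xt _].
    by case: (thD lam (le_lt_trans x0 xt)).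
  - by rewrite in_itv/= xy/= ltrDl ltr01.
  - move=> t; rewrite in_itv/= => /andP[xt _].
    by rewrite -ny; apply: angle_npi_le nx => //; exact: ltW.
have [_ D1] := thD lam y0; case: D => _; rewrite D1.
rewrite /angle_rhs -ny cos2sin2 sin_npi expr0n /= mul0r !mulr0 subr0 !addr0.
by apply/eqP; rewrite oner_eq0.
Qed.

(** At n pi + pi/2 the slope is lam - z - p z. The offset M + 1 from [lam] makes it at most -1. *)
Lemma angle_pihalf_le n (lam x y : R) : 0 <= x -> lam + (M + 1) <= x -> x <= y ->
  th lam x <= n%:R * pi + pi / 2 -> th lam y <= n%:R * pi + pi / 2.
Proof.
move=> x0 lx xy; have [L L1 hL] := angle_rhs_lipschitz y `|lam|.
have ct := @cth lam.
rewrite -!(subr_le0 (n%:R * pi + pi / 2)).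
apply: (@differential_barrier _ (fun x => th lam x - (n%:R * pi + pi / 2))
  (fun x => angle_rhs lam x (th lam x)) L) => //.
- by cont.
- move=> z xz zy; have h := thD lam (le_lt_trans x0 xz); der_to; ring.
- move=> z xz zy dz.
  have := hL lam z (lexx _) _ (th lam z) (n%:R * pi + pi / 2).
  rewrite (ltW (le_lt_trans x0 xz)) (ltW zy) (ger0_norm (ltW dz)) => /(_ isT).
  move=> /(le_trans (ler_norm _)).
  have -> : angle_rhs lam z (n%:R * pi + pi / 2) = lam - z - p z.
    by rewrite /angle_rhs sin2cos2 cos_npi_pihalf expr0n /= !mulr0 subr0 !add0r mulr1.
  by have := pM (ltW (le_lt_trans x0 xz)); rewrite ler_norml; lra.
Qed.

Lemma angle_pihalf_lt n (lam x y : R) : 0 <= x -> lam + (M + 1) <= x -> x < y ->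
  th lam x <= n%:R * pi + pi / 2 -> th lam y < n%:R * pi + pi / 2.
Proof.
move=> x0 lx xy nx; rewrite lt_neqAle (angle_pihalf_le x0 lx (ltW xy) nx) andbT; apply/eqP => ny.
have y0 := le_lt_trans x0 xy.
have D : is_derive y 1 (th lam) 0.
  apply: (@derive1_at_max _ (th lam) x (y + 1)); first by lra.
  - move=> t; rewrite in_itv/= => /andP[xt _].
    by case: (thD lam (le_lt_trans x0 xt)).
  - by rewrite in_itv/= xy/= ltrDl ltr01.
  - move=> t; rewrite in_itv/= => /andP[xt _].
    by rewrite ny; apply: (angle_pihalf_le x0 lx (ltW xt)).
have [_ D1] := thD lam y0; case: D => _; rewrite D1.
rewrite /angle_rhs ny sin2cos2 cos_npi_pihalf expr0n /= !mulr0 subr0 !add0r mulr1.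
by have := pM (ltW y0); rewrite ler_norml; lra.
Qed.

(** * Amplitude, solutions and square integrability *)

Let amp_rate (lam x : R) : R := let y := th lam x in
  Q x * (sin y ^+ 2 - cos y ^+ 2) + (1 + x - lam + p x) * (sin y * cos y).

(** [amp_rate] is the logarithmic derivative of sqrt (u^2 + w^2), so angle and amplitude together
    recover the solution (u, w), of length 1 at 0. *)
Definition amplitude (lam x : R) : R := expR (antideriv (amp_rate lam) x).
Definition solu (lam x : R) : R := amplitude lam x * sin (th lam x).
Definition solw (lam x : R) : R := amplitude lam x * cos (th lam x).

Let c_amp_rate lam : continuous (amp_rate lam).
Proof. by have c := @cth lam; rewrite /amp_rate; cont. Qed.

Lemma amplitude_gt0 (lam x : R) : 0 < amplitude lam x. Proof. exact: expR_gt0. Qed.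

Lemma continuous_amplitude (lam : R) : continuous (amplitude lam).
Proof. by have := continuous_antideriv (@c_amp_rate lam) => ?; rewrite /amplitude; cont. Qed.

Lemma continuous_solu (lam : R) : continuous (solu lam).
Proof. by have := @continuous_amplitude lam => ?; have c := @cth lam; rewrite /solu; cont. Qed.

Lemma continuous_solw (lam : R) : continuous (solw lam).
Proof. by have := @continuous_amplitude lam => ?; have c := @cth lam; rewrite /solw; cont. Qed.

Let ampD (lam x : R) : 0 < x -> is_derive x 1 (amplitude lam) (amp_rate lam x * amplitude lam x).
Proof.
move=> x0; have h := is_derive_antideriv (@c_amp_rate lam) x0.
by rewrite /amplitude; der_to; ring.
Qed.

Lemma is_derive_solu (lam x : R) : 0 < x ->
  is_derive x 1 (solu lam) (Q x * solu lam x + solw lam x).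
Proof.
move=> x0; have h1 := ampD lam x0; have h2 := thD lam x0.
rewrite /solu /solw; der_to; rewrite /amp_rate /angle_rhs.
move: (sin2Dcos2 (th lam x)); set s := sin _; set c := cos _; set A := amplitude _ _ => E.
transitivity ((s ^+ 2 + c ^+ 2) * (Q x * (A * s) + A * c)); first by ring.
by rewrite E mul1r.
Qed.

Lemma is_derive_solw (lam x : R) : 0 < x ->
  is_derive x 1 (solw lam) ((x - lam + p x) * solu lam x - Q x * solw lam x).
Proof.
move=> x0; have h1 := ampD lam x0; have h2 := thD lam x0.
rewrite /solu /solw; der_to; rewrite /amp_rate /angle_rhs.
move: (sin2Dcos2 (th lam x)); set s := sin _; set c := cos _; set A := amplitude _ _ => E.
transitivity ((s ^+ 2 + c ^+ 2) * ((x - lam + p x) * (A * s) - Q x * (A * c))); first by ring.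
by rewrite E mul1r.
Qed.

(** The Q terms of u' and w' cancel in the product, so only the sign of x - lam + p matters. *)
Lemma is_derive_soluw (lam x : R) : 0 < x ->
  is_derive x 1 (fun x => solu lam x * solw lam x)
    (solw lam x ^+ 2 + (x - lam + p x) * solu lam x ^+ 2).
Proof.
move=> x0; have h1 := is_derive_solu lam x0; have h2 := is_derive_solw lam x0.
by der_to; ring.
Qed.

(** For a nonnegative integrand, bounded partial integrals amount to integrability on the
    half-line. *)
Definition square_integrable_solu (lam : R) : Prop :=
  exists K : R, forall x, 0 <= x -> antideriv (fun t => solu lam t ^+ 2) x <= K.

Let potential_ge1 (lam x : R) : 0 <= x -> lam + (M + 1) <= x -> 1 <= x - lam + p x.
Proof. by move=> x0 lx; have := pM x0; rewrite ler_norml; lra. Qed.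

Lemma soluw_growth (lam a b : R) : 0 <= a -> lam + (M + 1) <= a -> a <= b ->
  antideriv (fun t => solu lam t ^+ 2 + solw lam t ^+ 2) b -
  antideriv (fun t => solu lam t ^+ 2 + solw lam t ^+ 2) a <=
  solu lam b * solw lam b - solu lam a * solw lam a.
Proof.
move=> a0 la ab.
have c1 := @continuous_solu lam; have c2 := @continuous_solw lam.
have cf : continuous (fun t => solu lam t ^+ 2 + solw lam t ^+ 2) by cont.
apply: (@derive_le _ (antideriv (fun t => solu lam t ^+ 2 + solw lam t ^+ 2))
  (fun x => solu lam x * solw lam x) (fun t => solu lam t ^+ 2 + solw lam t ^+ 2)
  (fun x => solw lam x ^+ 2 + (x - lam + p x) * solu lam x ^+ 2)) => //.
- exact: continuous_antideriv.
- by cont.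
- by move=> x ax xb; apply: is_derive_antideriv => //; exact: le_lt_trans ax.
- by move=> x ax xb; apply: is_derive_soluw; exact: le_lt_trans ax.
- move=> x ax xb; rewrite addrC lerD2l ler_peMl ?sqr_ge0//.
  by apply: potential_ge1; lra.
Qed.

Let cu2 (lam : R) : continuous (fun t => solu lam t ^+ 2).
Proof. by have c1 := @continuous_solu lam; cont. Qed.

Let cuw2 (lam : R) : continuous (fun t => solu lam t ^+ 2 + solw lam t ^+ 2).
Proof. by have c1 := @continuous_solu lam; have c2 := @continuous_solw lam; cont. Qed.

(** If u w = d > 0 at some x1, then u w >= d from there on, and (u^2)' = 2 Q u^2 + 2 u w >= 2 d - 2
    M u^2. With the integral of u^2 bounded by K, u^2 grows linearly, which is absurd. Conversely,
    if u w stays nonpositive, its growth bounds the integral of u^2 + w^2. *)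
Lemma square_integrable_soluP (lam : R) : 0 <= lam ->
  square_integrable_solu lam <->
  (forall x, lam + (M + 1) <= x -> solu lam x * solw lam x <= 0).
Proof.
move=> lam0; have c1 := @continuous_solu lam; have c2 := @continuous_solw lam.
split=> [[K hK] x1 lx1|uw0].
- rewrite leNgt; apply/negP => d0.
  set d := solu lam x1 * solw lam x1 in d0.
  have x10 : 0 <= x1 by move: M0; lra.
  have M0' := M0.
  have uwd x : x1 <= x -> d <= solu lam x * solw lam x.
    move=> x1x; have := soluw_growth x10 lx1 x1x.
    have : antideriv (fun t => solu lam t ^+ 2 + solw lam t ^+ 2) x1 <=
           antideriv (fun t => solu lam t ^+ 2 + solw lam t ^+ 2) x.
      by apply: antideriv_ge0_le => // z _; rewrite addr_ge0 ?sqr_ge0.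
    rewrite -/d; lra.
  have cA := continuous_antideriv (@cu2 lam).
  set A := antideriv _ in hK cA.
  have A0 x : 0 <= x -> 0 <= A x.
    move=> x0; rewrite -[leLHS](_ : A 0 = 0); last by rewrite /A antideriv_le0.
    by apply: antideriv_ge0_le => // z _; rewrite sqr_ge0.
  have u2 x : x1 <= x -> 2 * d * (x - x1) - 2 * M * K <= solu lam x ^+ 2.
    move=> x1x.
    have : 2 * d * x - 2 * d * x1 <=
      (solu lam x ^+ 2 + 2 * M * A x) - (solu lam x1 ^+ 2 + 2 * M * A x1).
      apply: (@derive_le _ (fun x => 2 * d * x) (fun x => solu lam x ^+ 2 + 2 * M * A x)
        (fun=> 2 * d)
        (fun x => 2 * solu lam x * (Q x * solu lam x + solw lam x) + 2 * M * solu lam x ^+ 2)) => //.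
      + by cont.
      + by cont.
      + by move=> y _ _; der_to; ring.
      + move=> y x1y _; have y0 : 0 < y by exact: le_lt_trans x1y.
        have h1 := is_derive_solu lam y0; have h2 := is_derive_antideriv (@cu2 lam) y0.
        by rewrite /A; der_to; rewrite /=; ring.
      + move=> y x1y _; have := uwd y (ltW x1y).
        have y0 : 0 <= y by exact: le_trans (ltW x1y).
        have := QM y0; rewrite ler_norml => /andP[+ _].
        have := sqr_ge0 (solu lam y); nra.
    have := A0 x1 x10; have := hK x (le_trans x10 x1x); have := sqr_ge0 (solu lam x1); nra.
  have d2 : 0 < 2 * d by rewrite mulr_gt0.
  (* From x2 on u^2 >= 1, so the next K + 1 units of length exceed the bound K. *)
  have [x2 x12 x2E] : exists2 x2, x1 <= x2 & 2 * d * (x2 - x1) = `|2 * M * K| + 1.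
    exists (x1 + (`|2 * M * K| + 1) / (2 * d)); last by field; rewrite lt0r_neq0.
    by rewrite lerDl divr_ge0 ?addr_ge0// ltW.
  have u1 x : x2 <= x -> 1 <= solu lam x ^+ 2.
    move=> x2x; apply: le_trans (u2 x (le_trans x12 x2x)).
    have : 2 * d * (x2 - x1) <= 2 * d * (x - x1) by rewrite (ler_pM2l d2) lerD2r.
    rewrite x2E.
    have := ler_norm (2 * M * K); lra.
  have K0 : 0 <= K by exact: le_trans (A0 0 (lexx 0)) (hK 0 (lexx 0)).
  have : (x2 + (K + 1)) - x2 <= A (x2 + (K + 1)) - A x2.
    apply: (@derive_le _ (fun x => x) A (fun=> 1) (fun x => solu lam x ^+ 2)) => //.
    + by cont.
    + by lra.
    + move=> y x2y _; apply: is_derive_antideriv; first exact: cu2.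
      exact: le_lt_trans (le_trans x10 x12) x2y.
    + by move=> y x2y _; apply: u1; exact: ltW.
  have := A0 x2 (le_trans x10 x12); have := hK (x2 + (K + 1)) _; lra.
- pose a := lam + (M + 1).
  have a0 : 0 <= a by rewrite /a; move: M0; lra.
  exists (antideriv (fun t => solu lam t ^+ 2) a - solu lam a * solw lam a) => x x0.
  have u0 z : 0 <= z -> 0 <= solu lam z ^+ 2 by rewrite sqr_ge0.
  have uwa : solu lam a * solw lam a <= 0 by apply: uw0.
  have [xa|/ltW ax] := leP x a.
    by have := antideriv_ge0_le (@cu2 lam) u0 x0 xa; lra.
  have : antideriv (fun t => solu lam t ^+ 2) x - antideriv (fun t => solu lam t ^+ 2) a <=
    antideriv (fun t => solu lam t ^+ 2 + solw lam t ^+ 2) x -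
    antideriv (fun t => solu lam t ^+ 2 + solw lam t ^+ 2) a.
    apply: (@derive_le _ (antideriv (fun t => solu lam t ^+ 2))
      (antideriv (fun t => solu lam t ^+ 2 + solw lam t ^+ 2))
      (fun t => solu lam t ^+ 2) (fun t => solu lam t ^+ 2 + solw lam t ^+ 2)) => //.
    + exact: continuous_antideriv.
    + exact: continuous_antideriv.
    + by move=> y ay _; apply: is_derive_antideriv; [exact: cu2|exact: le_lt_trans ay].
    + by move=> y ay _; apply: is_derive_antideriv; [exact: cuw2|exact: le_lt_trans ay].
    + by move=> y _ _; rewrite lerDl sqr_ge0.
  have := soluw_growth a0 (lexx a) ax.
  have := uw0 x ax; lra.
Qed.

(** * The index of an eigenvalue *)

Let soluw_gt0 (lam x : R) : 0 < sin (th lam x) * cos (th lam x) -> 0 < solu lam x * solw lam x.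
Proof.
move=> h; rewrite /solu /solw mulrACA mulr_gt0//.
by rewrite mulr_gt0// amplitude_gt0.
Qed.

(* The angle of a decaying solution ends up in a cone where u and w have opposite signs. *)
Definition angle_index (lam : R) (n : nat) : Prop := forall x : R, lam + (M + 1) <= x ->
  n%:R * pi + pi / 2 < th lam x /\ th lam x < n.+1%:R * pi.

(** Any other behaviour of the angle passes, beyond the turning point, through a quadrant where u w
    > 0: just after falling to n pi + pi/2, or just above (n+1) pi. *)
Lemma square_integrable_angle_index (lam : R) : 0 <= lam ->
  square_integrable_solu lam -> exists n, angle_index lam n.
Proof.
move=> lam0 /(square_integrable_soluP lam0) uw0.
have p0 := @pi_gt0 R.
pose a := lam + (M + 1).
have a0 : 0 <= a by rewrite /a; move: M0; lra.
have ta0 : 0 <= th lam a.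
  have := @angle_npi_le 0%N lam 0 a (lexx _) a0; rewrite mul0r th0; exact.
pose n := Num.truncn (th lam a / pi).
have /andP[n1 n2] : n%:R <= th lam a / pi < n.+1%:R by apply: truncn_itv; rewrite divr_ge0// ltW.
move: n1 n2; rewrite ler_pdivlMr// ltr_pdivrMr// => n1 n2.
have nS : n.+1%:R * pi = n%:R * pi + pi :> R by rewrite -natr1; ring.
exists n => x ax; split.
- rewrite ltNge; apply/negP => xn.
  have x0 : 0 <= x := le_trans a0 ax.
  have xx1 : x < x + 1 by rewrite ltrDl.
  have h1 := angle_pihalf_lt x0 ax xx1 xn.
  have h2 := angle_npi_lt a0 (le_lt_trans ax xx1) n1.
  have := soluw_gt0 (sin_cos_gt0 h2 h1).
  by rewrite ltNge uw0//; exact: le_trans (ltW xx1).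
- rewrite ltNge; apply/negP => xn.
  have x0 : 0 <= x := le_trans a0 ax.
  have xx1 : x < x + 1 by rewrite ltrDl.
  have h := angle_npi_lt x0 xx1 xn.
  (* A value the angle takes that is also inside the quadrant, even if the angle at x + 1 has
     already left it. *)
  pose v := Num.min (th lam (x + 1)) (n.+1%:R * pi + pi / 4).
  have [v1 v2] : n.+1%:R * pi < v /\ v < n.+1%:R * pi + pi / 2.
    by rewrite /v lt_min gt_min h; split; [lra|apply/orP; right; lra].
  have [y] : exists2 y, y \in `[a, x + 1] & th lam y = v.
    apply: IVT; first exact: le_trans ax (ltW xx1).
    - exact/continuous_subspaceT/cth.
    - by rewrite ge_min le_max; apply/andP; split; apply/orP; [left; lra|right;
      rewrite /v ge_min lexx].
  rewrite in_itv/= => /andP[ay _] yv.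
  have := @soluw_gt0 lam y; rewrite yv => /(_ (sin_cos_gt0 v1 v2)).
  by rewrite ltNge uw0.
Qed.

Lemma angle_index_square_integrable (lam : R) n : 0 <= lam ->
  angle_index lam n -> square_integrable_solu lam.
Proof.
move=> lam0 ni; apply/(square_integrable_soluP lam0) => x ax.
have [h1 h2] := ni x ax.
rewrite /solu /solw mulrACA mulr_ge0_le0//; first by rewrite mulr_ge0// ltW// amplitude_gt0.
by apply: (@sin_cos_le0 _ n); exact/ltW.
Qed.

Lemma angle_index_le (lam mu : R) m n : 0 <= lam -> lam <= mu ->
  angle_index lam m -> angle_index mu n -> (m <= n)%N.
Proof.
move=> lam0 lm hm hn; have p0 := @pi_gt0 R.
have M0' := M0.
have [h1 _] := hm (mu + (M + 1)) ltac:(by rewrite lerD2r).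
have [_ h2] := hn (mu + (M + 1)) (lexx _).
have h3 : th lam (mu + (M + 1)) <= th mu (mu + (M + 1)) by apply: angle_mono => //; lra.
have : m%:R * pi < n.+1%:R * pi :> R by lra.
by rewrite ltr_pM2r// ltr_nat ltnS.
Qed.

(* The Wronskian of two decaying solutions with the same index would stay away from 0. *)
Lemma angle_index_neq (lam mu : R) n : 0 <= lam -> lam < mu ->
  angle_index lam n -> angle_index mu n -> False.
Proof.
move=> lam0 lm hl hm; have p0 := @pi_gt0 R; have M0' := M0.
have mu0 : 0 <= mu by lra.
pose a := mu + (M + 1).
have a0 : 0 <= a by rewrite /a; lra.
have la : lam + (M + 1) <= a by rewrite /a; lra.
have c1 := @continuous_solu lam; have c2 := @continuous_solw lam.
have c3 := @continuous_solu mu; have c4 := @continuous_solw mu.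
pose W (x : R) : R := solu lam x * solw mu x - solu mu x * solw lam x.
have cW : continuous W by rewrite /W; cont.
have WD (x : R) : 0 < x -> is_derive x 1 W ((lam - mu) * (solu lam x * solu mu x)).
  move=> x0; have d1 := is_derive_solu lam x0; have d2 := is_derive_solw lam x0.
  have d3 := is_derive_solu mu x0; have d4 := is_derive_solw mu x0.
  by rewrite /W; der_to; ring.
have uu (x : R) : a <= x -> 0 < solu lam x * solu mu x.
  move=> ax; have [l1 l2] := hl x (le_trans la ax); have [m1 m2] := hm x ax.
  rewrite /solu mulrACA; apply: mulr_gt0; first by rewrite mulr_gt0// amplitude_gt0.
  by apply: (@sin_sin_gt0 _ n); lra.
have W'0 (x : R) : a <= x -> (lam - mu) * (solu lam x * solu mu x) < 0.
  by move=> ax; rewrite nmulr_rlt0 ?uu// subr_lt0.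
(* Up to a positive factor, W a is minus the sine of the difference of the angles, which lies in
   [0, pi] as the indices agree. *)
have Wa : W a <= 0.
  have [l1 l2] := hl a la; have [m1 m2] := hm a (lexx _).
  have lma : th lam a <= th mu a by apply: angle_mono => //; exact: ltW.
  rewrite /W /solu /solw.
  rewrite (_ : _ - _ = - (amplitude lam a * amplitude mu a * sin (th mu a - th lam a))); last first.
    by rewrite sinB; ring.
  rewrite oppr_le0 mulr_ge0//; first by rewrite mulr_ge0// ltW// amplitude_gt0.
  have nS : n.+1%:R * pi = n%:R * pi + pi :> R by rewrite -natr1; ring.
  by apply: sin_ge0_pi; apply/andP; split; lra.
pose d := - W (a + 1).
have d0 : 0 < d.
  rewrite /d; have : - W a < - W (a + 1).
    apply: (@derive_gt0_lt _ (fun x => - W x) (fun x => - ((lam - mu) * (solu lam x * solu mu x)))).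
    - by cont.
    - by rewrite ltrDl.
    - by move=> x ax _; have := WD x (le_lt_trans a0 ax) => ?; der.
    - by move=> x ax _; rewrite oppr_gt0 W'0// ltW.
  lra.
have Wd (x : R) : a + 1 <= x -> d <= - W x.
  move=> ax; apply: (@derive_ge0_le _ (fun x => - W x)
    (fun x => - ((lam - mu) * (solu lam x * solu mu x)))) => //.
  - by cont.
  - by move=> y ay _; have := WD y ltac:(lra) => ?; der.
  - by move=> y ay _; rewrite oppr_ge0 ltW// W'0//; lra.
(* Beyond a, S' is at least the sum of the four squares, and (u1 + w2)^2 + (u2 - w1)^2 >= 0 bounds
   that sum below by -2 W >= 2 d. So S becomes positive, while decay makes both products
   nonpositive. *)
pose S (x : R) : R := solu lam x * solw lam x + solu mu x * solw mu x.
have [x3 x31 x3E] : exists2 x3 : R, a + 1 <= x3 & 2 * d * (x3 - (a + 1)) = 1 + `|S (a + 1)|.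
  exists (a + 1 + (1 + `|S (a + 1)|) / (2 * d)); last by field; rewrite lt0r_neq0.
  by rewrite lerDl divr_ge0 ?addr_ge0// mulr_ge0// ltW.
have : 2 * d * x3 - 2 * d * (a + 1) <= S x3 - S (a + 1).
  apply: (@derive_le _ (fun x => 2 * d * x) S (fun=> 2 * d)
   (fun x => (solw lam x ^+ 2 + (x - lam + p x) * solu lam x ^+ 2) +
             (solw mu x ^+ 2 + (x - mu + p x) * solu mu x ^+ 2))) => //.
  - by cont.
  - by rewrite /S; cont.
  - by move=> x _ _; der_to; ring.
  - move=> x ax _; have x0 : 0 < x by lra.
    by have d1 := is_derive_soluw lam x0; have d2 := is_derive_soluw mu x0; rewrite /S; der.
  - move=> x ax _; have := Wd x (ltW ax); rewrite /W.
    have x0 : 0 <= x by lra.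
    have v1 : 1 <= x - lam + p x by apply: potential_ge1; lra.
    have v2 : 1 <= x - mu + p x by apply: potential_ge1; rewrite -/a; lra.
    have e1 : solu lam x ^+ 2 <= (x - lam + p x) * solu lam x ^+ 2 by rewrite ler_peMl ?sqr_ge0.
    have e2 : solu mu x ^+ 2 <= (x - mu + p x) * solu mu x ^+ 2 by rewrite ler_peMl ?sqr_ge0.
    have := sqr_ge0 (solu lam x + solw mu x); have := sqr_ge0 (solu mu x - solw lam x).
    lra.
rewrite -mulrBr x3E.
have : S x3 <= 0.
  have s1 := angle_index_square_integrable lam0 hl; have s2 := angle_index_square_integrable mu0 hm.
  rewrite /S; have := (square_integrable_soluP lam0).1 s1 x3 ltac:(lra).
  have := (square_integrable_soluP mu0).1 s2 x3 ltac:(rewrite -/a; lra).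
  lra.
have := ler_norm (- S (a + 1)); rewrite normrN; lra.
Qed.

(** Both failures at the supremum s are stable in the parameter. If the angle of s falls to n pi +
    pi/2, so does that of slightly larger parameters; if it reaches (n+1) pi, nearby smaller
    parameters of the set do too and can never fall. *)
Lemma angle_index_exists (l1 l2 : R) n : 0 <= l1 -> l1 <= l2 ->
  th l1 (l1 + (M + 1)) <= n%:R * pi + pi / 2 ->
  n.+1%:R * pi <= th l2 (l2 + (M + 1)) ->
  exists2 lam : R, l1 <= lam & angle_index lam n.
Proof.
move=> l10 l12 t1 t2; have p0 := @pi_gt0 R; have M0' := M0.
have nS : n.+1%:R * pi = n%:R * pi + pi :> R by rewrite -natr1; ring.
pose A := [set lam : R | l1 <= lam /\ lam <= l2 /\
  exists2 x : R, lam + (M + 1) <= x & th lam x <= n%:R * pi + pi / 2].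
have Al1 : A l1 by split=> //; split=> //; exists (l1 + (M + 1)).
have ubA : ubound A l2 by move=> x [_ []].
have supA : has_sup A by split; [exists l1|exists l2].
pose s := sup A.
have l1s : l1 <= s by apply: ub_le_sup => //; exists l2.
have sl2 : s <= l2 by apply: ge_sup => //; exists l1.
have s0 : 0 <= s by lra.
exists s => // x sx.
have x0 : 0 <= x by lra.
have xx1 : x < x + 1 by rewrite ltrDl.
have [K K0 hK] := angle_continuous_param (x + 1) l2.
split; rewrite ltNge; apply/negP => xn.
- have h := angle_pihalf_lt x0 sx xx1 xn.
  (* For s = l2 no larger parameter is available, but there the hypothesis at l2 already keeps the
     angle above (n+1) pi. *)
  have [sl|] := ltP s l2; last first.
    move=> l2s; have e : s = l2 by apply/eqP; rewrite eq_le sl2.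
    have := @angle_npi_le n.+1 l2 (l2 + (M + 1)) (x + 1) ltac:(lra) ltac:(rewrite -e; lra) t2.
    by rewrite -e nS; lra.
  pose e := (n%:R * pi + pi / 2 - th s (x + 1)) / K.
  have e0 : 0 < e by rewrite divr_gt0// subr_gt0.
  (* The bound e keeps the angle at x + 1 below n pi + pi/2, the bound 1 keeps x + 1 in the barrier
     region, and l2 - s keeps [lam] in range. *)
  pose lam := s + Num.min (Num.min e 1) (l2 - s).
  have [lams [lam1 [lame laml2]]] : s < lam /\ lam <= s + 1 /\ lam - s <= e /\ lam <= l2.
    have m0 : 0 < Num.min (Num.min e 1) (l2 - s) by rewrite !lt_min e0 ltr01 subr_gt0 sl.
    have [m1 m2] : Num.min (Num.min e 1) (l2 - s) <= Num.min e 1 /\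
      Num.min (Num.min e 1) (l2 - s) <= l2 - s.
      by split; rewrite ge_min lexx ?orbT.
    have [m3 m4] : Num.min e 1 <= e /\ Num.min e 1 <= 1 by split; rewrite ge_min lexx ?orbT.
    by rewrite /lam; do !split; lra.
  have : lam <= s.
    apply: ub_le_sup; first by exists l2.
    split; first by lra.
    split=> //; exists (x + 1); first by lra.
    have := hK s lam; rewrite ger0_norm// => /(_ sl2 (ltW lams) ltac:(lra)).
    have : (lam - s) * K <= e * K by rewrite ler_pM2r.
    rewrite /e divfK ?lt0r_neq0//; lra.
  by rewrite leNgt lams.
- have h := angle_npi_lt x0 xx1 xn.
  pose e := (th s (x + 1) - n.+1%:R * pi) / K.
  have e0 : 0 < e by rewrite divr_gt0// subr_gt0.
  have [lam Alam lams] := sup_adherent e0 supA.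
  have {}lams : s - e < lam by exact: lams.
  have lams' : lam <= s by apply: ub_le_sup => //; exists l2.
  case: Alam => l1lam [laml2 [y lamy yn]].
  have h2 : n.+1%:R * pi <= th lam (x + 1).
    have := hK lam s; rewrite ger0_norm; last by lra.
    move=> /(_ laml2 lams' ltac:(lra)).
    have : (s - lam) * K <= e * K by rewrite ler_pM2r//; lra.
    rewrite /e divfK ?lt0r_neq0//; lra.
  (* At z both barriers apply and contradict each other. *)
  pose z := Num.max y (x + 1).
  have [zy zx] : y <= z /\ x + 1 <= z by split; rewrite le_max lexx ?orbT.
  have y0 : 0 <= y by lra.
  have := angle_pihalf_le y0 lamy zy yn.
  have := @angle_npi_le n.+1 lam (x + 1) z ltac:(lra) zx h2.
  lra.
Qed.

(** * Size of the angle past the turning point *)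

Variables (B G : R -> R) (Gmax : R).
Hypotheses (QB : forall x : R, 0 <= x -> `|Q x| <= B x) (pB : forall x : R, 0 <= x -> `|p x| <= B x)
  (cG : continuous G) (GD : forall x : R, 0 < x -> is_derive x 1 G (B x))
  (G_bound : forall x : R, 0 <= x -> 0 <= G x /\ G x <= Gmax).

(** The bounded primitive [G] of the common majorant [B] is the form in which integrability of Q and
    p enters. *)
Lemma angle_asymptotics : exists C : R, forall lam : R, 1 <= lam ->
  `|th lam (lam + (M + 1)) - 2 / 3 * Num.sqrt lam ^+ 3| <= C.
Proof.
have M0' := M0.
(* The 1 covers 2/3 + 1/6 at x = lam - 1, where k = 1. The 2 pi is the cost of passing to the
   modified angle at both ends, and the last product bounds the change over a window of length M +
   2. *)
exists (4 * Gmax + 1 + 2 * pi + t0 + (4 * M + 2) * (M + 2)) => lam lam1.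
have [k [ck k1 kD k_0 k_l]] := wave_number_exists lam1.
have k_neq0 x : k x != 0 by apply: lt0r_neq0; have := k1 x; lra.
have ct := @cth lam.
pose eta (x : R) := modified_angle (k x) (th lam x).
have ceta : continuous eta by exact: continuous_modified_angle.
have /choice[d dP] : forall x : R, exists d : R, 0 < x -> x < lam - 1 ->
    is_derive x 1 eta d /\ `|d - k x| <= 4 * B x + 4^-1 * (k x)^-1 ^+ 5.
  move=> x.
  have [x0|x0] := ltP 0 x; last by exists 0.
  have [xl|lx] := ltP x (lam - 1); last by exists 0.
  have [kx2 kxD] := kD x xl.
  have [|d dD db] := @is_derive_modified_angle _ k (th lam) x (Q x) (p x) (k1 x) kxD.
    by rewrite kx2; exact: thD.
  exists d => _ _; split=> //; apply: le_trans db _.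
  rewrite lerD2r ler_pM2l// ge_max.
  by rewrite QB ?pB// ltW.
have ck1 : continuous (fun x => (k x)^-1) by exact: cont_inv.
have l10 : 0 <= lam - 1 by lra.
(* Since k' = -1/(2 k), the derivative of (2/3) k^3 is -k and that of k^-3 / 6 is k^-5 / 4. *)
have main : `|(eta (lam - 1) + 2 / 3 * k (lam - 1) ^+ 3) - (eta 0 + 2 / 3 * k 0 ^+ 3)| <=
    (4 * G (lam - 1) + 6^-1 * (k (lam - 1))^-1 ^+ 3) - (4 * G 0 + 6^-1 * (k 0)^-1 ^+ 3).
  apply: (@norm_derive_le _ (fun x => eta x + 2 / 3 * k x ^+ 3) (fun x => d x - k x)
    (fun x => 4 * G x + 6^-1 * (k x)^-1 ^+ 3) (fun x => 4 * B x + 4^-1 * (k x)^-1 ^+ 5)) => //.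
  - by cont.
  - by cont.
  - move=> x x0 xl; have [h _] := dP x x0 xl; have [_ hk] := kD x xl.
    have kx := k_neq0 x.
    by der_to; field.
  - move=> x x0 xl; have [_ hk] := kD x xl; have hG := GD x0.
    have kx := k_neq0 x.
    by der_to => //; field.
  - by move=> x x0 xl; have [_] := dP x x0 xl.
have [G00 G0m] := G_bound (lexx 0); have [Gl0 Glm] := G_bound l10.
have e0 := @modified_angle_close _ (k 0) (th lam 0) (k1 0).
have el := @modified_angle_close _ (k (lam - 1)) (th lam (lam - 1)) (k1 _).
have window : `|th lam (lam + (M + 1)) - th lam (lam - 1)| <= (4 * M + 2) * (M + 2).
  have := @norm_derive_le _ (th lam) (fun x => angle_rhs lam x (th lam x))
    (fun x => (4 * M + 2) * x) (fun=> 4 * M + 2) (lam - 1) (lam + (M + 1)).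
  rewrite (_ : (4 * M + 2) * (lam + (M + 1)) - (4 * M + 2) * (lam - 1) = (4 * M + 2) * (M + 2));
    last by ring.
  apply => //; try by cont.
  - lra.
  - by move=> x lx _; apply: thD; lra.
  - by move=> x _ _; der_to; ring.
  - move=> x lx xl; have x0 : 0 <= x by lra.
    have := sin2Dcos2 (th lam x); rewrite /angle_rhs.
    move: (sin _) (cos _) => s c sc.
    have s2 := sqr_ge0 s; have c2 := sqr_ge0 c.
    have := QM x0; have := pM x0; rewrite !ler_norml => /andP[p1 p2] /andP[Q1 Q2].
    have sp := sqr_ge0 (s + c); have sm := sqr_ge0 (s - c).
    have V1 : lam - x - p x <= 2 * M + 1 by lra.
    have V2 : - (2 * M + 1) <= lam - x - p x by lra.
    have h1 : (lam - x - p x) * s ^+ 2 <= (2 * M + 1) by nra.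
    have h2 : - (2 * M + 1) <= (lam - x - p x) * s ^+ 2 by nra.
    have h3 : `|2 * Q x * (s * c)| <= M.
      rewrite (_ : 2 * Q x * (s * c) = Q x * (2 * (s * c))); last by ring.
      rewrite normrM -[leRHS]mulr1 ler_pM//; first by rewrite ler_norml Q1.
      by rewrite ler_norml; apply/andP; split; lra.
    by move: h3; rewrite ler_norml => /andP[? ?]; apply/andP; split; lra.
have k03 : 0 <= 6^-1 * (k 0)^-1 ^+ 3.
  by rewrite mulr_ge0// exprn_ge0// invr_ge0; have := k1 0; lra.
have p0 := @pi_ge0 R.
move: main window e0 el; rewrite /eta k_l k_0 invr1 !expr1n !th0.
rewrite k_0 in k03; rewrite !ler_norml.
have := t0_ge0.
lra.
Qed.

End angle.

(** * Absolutely continuous functions *)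

Section absolute_continuity.
Context {R : realType}.
Notation mu := (@lebesgue_measure R).
Implicit Types (f g : R -> R) (a b : R).

Lemma abs_cont_on_le f g a b : abs_cont_on a b g ->
  (forall x y, a <= x -> x <= y -> y <= b -> `|f y - f x| <= `|g y - g x|) -> abs_cont_on a b f.
Proof.
move=> acg fg e e0; have [d d0 dP] := acg e e0; exists d => // n s t st ts std.
apply: le_lt_trans (dP n s t st ts std); apply: ler_sum => i _.
by have [? [? ?]] := st i (ltn_ord i); exact: fg.
Qed.

Lemma abs_cont_on_lin f g h (A C a b : R) : abs_cont_on a b f -> abs_cont_on a b g ->
  (forall x y, a <= x -> x <= y -> y <= b -> `|h y - h x| <= A * `|f y - f x| + C * `|g y - g x|) ->
  abs_cont_on a b h.
Proof.
move=> acf acg hfg e e0.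
have A1 : 0 < `|A| + 1 by rewrite ltr_wpDl.
have C1 : 0 < `|C| + 1 by rewrite ltr_wpDl.
have [d d0 dP] := acf (e / 2 / (`|A| + 1)) ltac:(by rewrite !divr_gt0).
have [d' d'0 d'P] := acg (e / 2 / (`|C| + 1)) ltac:(by rewrite !divr_gt0).
exists (Num.min d d'); first by rewrite lt_min d0.
move=> n s t st ts; rewrite lt_min => /andP[std std'].
have h1 := dP n s t st ts std; have h2 := d'P n s t st ts std'.
apply: (@le_lt_trans _ _ (\sum_(i < n) ((`|A| + 1) * `|f (t i) - f (s i)| +
  (`|C| + 1) * `|g (t i) - g (s i)|))).
  apply: ler_sum => i _; have [? [? ?]] := st i (ltn_ord i).
  apply: le_trans (hfg _ _ _ _ _) _ => //; apply: lerD; apply: ler_wpM2r => //.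
    by rewrite (le_trans (ler_norm _))// lerDl.
  by rewrite (le_trans (ler_norm _))// lerDl.
rewrite big_split/= -!mulr_sumr [ltRHS](splitr e); apply: ltrD.
  by rewrite mulrC -ltr_pdivlMr.
by rewrite mulrC -ltr_pdivlMr.
Qed.

Lemma abs_cont_on_id a b : abs_cont_on a b (fun x : R => x).
Proof.
move=> e e0; exists e => // n s t st _; apply: le_lt_trans; apply: ler_sum => i _.
by have [_ [h _]] := st i (ltn_ord i); rewrite ger0_norm ?subr_ge0.
Qed.

Lemma abs_cont_on_lipschitz f (K a b : R) :
  (forall x y, a <= x -> x <= y -> y <= b -> `|f y - f x| <= K * (y - x)) -> abs_cont_on a b f.
Proof.
move=> fK; apply: (@abs_cont_on_lin _ _ _ K 0 _ _ (abs_cont_on_id a b) (abs_cont_on_id a b)) => x y ax xy yb.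
by rewrite mul0r addr0 (ger0_norm (_ : 0 <= y - x)) ?subr_ge0//; exact: fK.
Qed.

Lemma loc_abs_contB f g : loc_abs_cont f -> loc_abs_cont g -> loc_abs_cont (fun x => f x - g x).
Proof.
move=> acf acg b b0; apply: (@abs_cont_on_lin f g _ 1 1) => [||x y _ _ _]; [exact: acf|exact: acg|].
rewrite !mul1r (_ : _ - _ = (f y - f x) - (g y - g x)); last by ring.
exact: ler_normB.
Qed.

Lemma loc_abs_contD f g : loc_abs_cont f -> loc_abs_cont g -> loc_abs_cont (fun x => f x + g x).
Proof.
move=> acf acg b b0; apply: (@abs_cont_on_lin f g _ 1 1) => [||x y _ _ _]; [exact: acf|exact: acg|].
rewrite !mul1r (_ : _ - _ = (f y - f x) + (g y - g x)); last by ring.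
exact: ler_normD.
Qed.

Lemma loc_abs_contM f g : continuous f -> continuous g ->
  loc_abs_cont f -> loc_abs_cont g -> loc_abs_cont (fun x => f x * g x).
Proof.
move=> cf cg acf acg b b0.
have [Mf Mf0 fM] := continuous_bounded 0 b cf; have [Mg Mg0 gM] := continuous_bounded 0 b cg.
apply: (@abs_cont_on_lin f g _ Mg Mf) => [||x y x0 xy yb]; [exact: acf|exact: acg|].
rewrite (_ : _ - _ = g y * (f y - f x) + f x * (g y - g x)); last by ring.
apply: le_trans (ler_normD _ _) _; rewrite !normrM; apply: lerD; apply: ler_wpM2r => //.
  by apply: gM; rewrite yb (le_trans x0).
by apply: fM; rewrite x0 (le_trans xy).
Qed.

Lemma loc_abs_cont_C1 f df : continuous f -> continuous df ->
  (forall x : R, 0 < x -> is_derive x 1 f (df x)) -> loc_abs_cont f.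
Proof.
move=> cf cdf fD b b0; have [K K0 dK] := continuous_bounded 0 b cdf.
apply: (@abs_cont_on_lipschitz _ K) => x y x0 xy yb; rewrite mulrBr.
apply: (@norm_derive_le _ f df (fun x => K * x) (fun=> K)) => //; first by cont.
- by move=> z xz _; apply: fD; exact: le_lt_trans xz.
- by move=> z _ _; der_to; ring.
- by move=> z xz zy; apply: dK; apply/andP; split; lra.
Qed.

Lemma loc_abs_cont_ext f g : (forall x, 0 <= x -> f x = g x) -> loc_abs_cont f -> loc_abs_cont g.
Proof.
move=> fg acf b b0; apply: (abs_cont_on_le (acf b b0)) => x y x0 xy _.
by rewrite !fg// (le_trans x0).
Qed.

(** Local absolute continuity is silent about x < 0, hence the clamping at 0. A single interval in
    the definition gives uniform continuity. *)
Lemma loc_abs_cont_continuous f : loc_abs_cont f -> continuous (fun x : R => f (Num.max x 0)).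
Proof.
move=> acf x; have b0 : 0 < `|x| + 1 by rewrite ltr_wpDl.
apply/cvgrPdist_lt => /= e e0; have [d d0 dP] := acf _ b0 e e0.
have ac2 y z : 0 <= y -> y <= z -> z <= `|x| + 1 -> z - y < d -> `|f z - f y| < e.
  move=> y0 yz zx zyd.
  have := dP 1%N (fun=> y) (fun=> z); rewrite !big_ord1; apply => //.
near=> y.
have yx1 : `|x - y| < 1 by near: y; exact: (nbhsx_ballx x 1).
have yxd : `|x - y| < d by near: y; exact: (nbhsx_ballx x d).
have xx : x <= `|x| by exact: ler_norm.
have mb z : `|x - z| < 1 -> Num.max z 0 <= `|x| + 1.
  rewrite ltr_norml => /andP[? ?]; rewrite ge_max; apply/andP; split; lra.
have Xb := mb x ltac:(by rewrite subrr normr0); have Yb := mb y yx1.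
have dXY : `|Num.max x 0 - Num.max y 0| < d.
  apply: le_lt_trans yxd; have := ler_norm (x - y); have := ler_norm (y - x).
  rewrite (distrC y); move: (`|x - y|) => N yN xN; rewrite ler_norml.
  by have [x0|x0] := leP x 0; have [y0|y0] := leP y 0; apply/andP; split; lra.
have X0 : 0 <= Num.max x 0 by rewrite le_max lexx orbT.
have Y0 : 0 <= Num.max y 0 by rewrite le_max lexx orbT.
have [XY|/ltW YX] := leP (Num.max x 0) (Num.max y 0).
- by rewrite distrC; apply: ac2 => //; move: dXY; rewrite distrC ger0_norm ?subr_ge0.
- by apply: ac2 => //; move: dXY; rewrite ger0_norm ?subr_ge0.
Unshelve. all: by end_near. Qed.
End absolute_continuity.

(** * Recovering a function from its almost everywhere derivative *)

Section abs_cont_primitive.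
Context {R : realType}.
Notation mu := (@lebesgue_measure R).
Implicit Types (f g h : R -> R) (a b : R).

(** Invariant of a sweep from 0 to b: the increment of h splits into a part of slope at most e and
    finitely many intervals whose length is charged to U. Measuring U only up to x leaves room for
    the next interval. *)
Let chain h (U : set R) (e x : R) : Prop := exists n (s t : nat -> R),
  [/\ forall i, (i < n)%N -> 0 <= s i /\ s i <= t i /\ t i <= x,
      forall i, (i.+1 < n)%N -> t i <= s i.+1,
      ((\sum_(i < n) (t i - s i))%R%:E <= mu (U `&` `]0%R, x]))%E &
      `|h x - h 0| <= e * x + \sum_(i < n) `|h (t i) - h (s i)|].

Let chain_weak h (U : set R) (e x y : R) : open U -> x <= y -> `|h y - h x| <= e * (y - x) ->
  chain h U e x -> chain h U e y.
Proof.
move=> oU xy hxy [n [s [t [h1 h2 h3 h4]]]]; exists n, s, t; split => //.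
- by move=> i /h1[? [? ?]]; do !split => //; exact: le_trans xy.
- apply: le_trans h3 _; apply: le_measure; rewrite ?inE.
  + by apply: measurableI => //; exact: measurable_realfun.open_measurable.
  + by apply: measurableI => //; exact: measurable_realfun.open_measurable.
  + by apply: setIS; apply: subset_itvl; rewrite bnd_simp.
- rewrite (_ : h y - h 0 = (h y - h x) + (h x - h 0)); last by ring.
  by apply: le_trans (ler_normD _ _) _; lra.
Qed.

(** The new interval lies beyond x, so additivity of the measure pays for its full length. *)
Let chain_cons h (U : set R) (e x y : R) : open U -> 0 <= e -> 0 <= x -> x <= y -> `]x, y] `<=` U ->
  chain h U e x -> chain h U e y.
Proof.
move=> oU e0 x0 xy xyU [n [s [t [h1 h2 h3 h4]]]].
pose s' i := if (i < n)%N then s i else x; pose t' i := if (i < n)%N then t i else y.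
have sE i : (i < n)%N -> s' i = s i by rewrite /s' => ->.
have tE i : (i < n)%N -> t' i = t i by rewrite /t' => ->.
have [sn tn] : s' n = x /\ t' n = y by rewrite /s' /t' ltnn.
have mU z w : measurable (U `&` `]z, w]).
  by apply: measurableI => //; exact: measurable_realfun.open_measurable.
exists n.+1, s', t'; split.
- move=> i; rewrite ltnS leq_eqVlt => /predU1P[->|ni]; first by rewrite sn tn.
  by rewrite sE// tE//; have [? [? ?]] := h1 i ni; do !split => //; exact: le_trans xy.
- move=> i; rewrite ltnS leq_eqVlt => /predU1P[ni|ni].
    have i_n : (i < n)%N by rewrite -ni.
    by rewrite ni sn tE//; have [_ []] := h1 i i_n.
  by rewrite sE// tE ?(ltnW ni)//; exact: h2.
- rewrite big_ord_recr/= sn tn.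
  under eq_bigr => i _ do rewrite sE// tE//.
  rewrite EFinD.
  have -> : U `&` `]0, y] = (U `&` `]0, x]) `|` `]x, y].
    apply/seteqP; split => z/=; rewrite !in_itv/=.
      move=> [Uz /andP[z0 zy]]; have [zx|xz] := leP z x; [left|right; rewrite ?xz] => //.
      by rewrite z0.
    move=> [[Uz /andP[z0 zx]]|/andP[xz zy]]; first by split=> //; rewrite z0 (le_trans zx).
    by split; [apply: xyU; rewrite /= in_itv/= xz|rewrite (le_lt_trans x0 xz)].
  rewrite measureU; [|exact: mU|exact: measurable_itv|].
    apply: leeD => //; suff : ((y - x)%:E <= mu `]x, y])%E by [].
    rewrite lebesgue_measure_itv/= lte_fin.
    by move: xy; rewrite le_eqVlt => /predU1P[->|->]; rewrite ?ltxx ?subrr ?EFinB.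
  apply/seteqP; split => // z/=; rewrite !in_itv/= => -[[_ /andP[_ zx]] /andP[xz _]].
  by move: xz; rewrite ltNge zx.
- rewrite big_ord_recr/= sn tn.
  under eq_bigr => i _ do rewrite sE// tE//.
  rewrite (_ : h y - h 0 = (h x - h 0) + (h y - h x)); last by ring.
  apply: le_trans (ler_normD _ _) _; rewrite addrA; apply: lerD => //.
  by apply: le_trans h4 _; rewrite lerD2r ler_wpM2l.
Qed.

(* Cousin-type argument: points where h' = 0 fails lie in an open set of small measure,
   on which absolute continuity controls h. *)
Lemma abs_cont_ae_derive0 h b : 0 < b -> continuous h -> abs_cont_on 0 b h ->
  {ae mu, forall x : R, 0 < x -> is_derive x 1 h 0} -> h b = h 0.
Proof.
move=> b0 ch ach [N [mN N0 hN]].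
suff key (e : R) : 0 < e -> `|h b - h 0| <= e * b + e.
  apply/eqP; rewrite -subr_eq0 -normr_le0; apply/ler_addgt0Pl => e e0; rewrite addr0.
  have e'0 : 0 < e / (b + 1) by rewrite divr_gt0//; lra.
  apply: le_trans (key _ e'0) _; rewrite le_eqVlt; apply/orP; left; apply/eqP.
  by field; apply: lt0r_neq0; lra.
move=> e0; have [d d0 dP] := ach e e0.
(* The hypothesis says nothing at 0, so 0 joins the exceptional set. *)
have mN0 : measurable (N `|` [set 0]) by apply: measurableU.
have muN0 : mu (N `|` [set 0]) = 0%E.
  apply/eqP; rewrite eq_le measure_ge0 andbT.
  have : (mu (N `|` [set 0%R]) <= mu N + mu [set 0%R])%E by exact: measureU2.
  by rewrite N0 lebesgue_measure_set1 adde0.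
have muN0y : (mu (N `|` [set 0%R]) < +oo)%E by rewrite muN0.
have [U [oU NU muU]] := lebesgue_regularity_outer mN0 muN0y d0.
have {}muU : (mu (U `\` (N `|` [set 0%R])) < d%:E)%E := muU.
have mU : measurable U by exact: measurable_realfun.open_measurable.
have {}muU : (mu U < d%:E)%E.
  rewrite (_ : U = (U `\` (N `|` [set 0])) `|` (N `|` [set 0])); last first.
    by rewrite setUC setDUK.
  have : (mu ((U `\` (N `|` [set 0%R])) `|` (N `|` [set 0%R])) <=
         mu (U `\` (N `|` [set 0%R])) + mu (N `|` [set 0%R]))%E.
    by apply: measureU2 => //; exact: measurableD.
  by rewrite muN0 adde0 => /le_lt_trans; exact.
(* Any chain ending just left of z extends past z: through an interval of U if z is in U, and
   otherwise with slope e because h' z = 0. *)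
have loc (z : R) : exists2 r : R, 0 < r & forall x y : R, 0 <= x -> z - r < x -> x <= z ->
  z <= y -> y < z + r ->
    chain h U e x -> chain h U e y.
  have [Uz|Uz] := pselect (U z).
    have /nbhs_ballP[r r0 rU] := open_nbhs_nbhs (conj oU Uz : open_nbhs z U).
    exists r => // x y x0 zx xz zy yr; apply: chain_cons => //; [exact: ltW|lra|].
    move=> w/=; rewrite in_itv/= => /andP[xw wy]; apply: rU; rewrite /ball/= ltr_norml.
    by apply/andP; split; lra.
  have nNz : ~ (N `|` [set 0]) z by move=> /NU.
  have [z0|z0] := leP z 0.
    exists 1 => // x y x0 _ xz _ _ _; exfalso; apply: nNz; right => /=; apply/eqP.
    by rewrite eq_le z0 (le_trans x0).
  have hz : is_derive z 1 h 0.
    apply: contrapT => nz; apply: nNz; left; apply: hN => /= hh; exact: nz (hh z0).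
  have := @is_derive1_caratheodory R h z 0.
  move=> /iffLR/(_ hz)[g [hg cg gz]].
  have /cvgrPdist_lt/(_ e e0) := cg; rewrite gz => /nbhs_ballP[r r0 rg].
  have hr (w : R) : `|w - z| < r -> `|h w - h z| <= e * `|w - z|.
    move=> wz; rewrite hg normrM ler_wpM2r//.
    have := rg w; rewrite /ball/= distrC => /(_ wz); rewrite sub0r normrN; exact: ltW.
  exists r => // x y x0 zx xz zy yr; apply: chain_weak => //; first exact: le_trans zy.
  rewrite (_ : h y - h x = (h y - h z) - (h x - h z)); last by ring.
  apply: le_trans (ler_normB _ _) _.
  have := hr y; rewrite ger0_norm ?subr_ge0// => /(_ ltac:(lra)).
  have := hr x; rewrite distrC ger0_norm ?subr_ge0// => /(_ ltac:(lra)).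
  lra.
have c0 : chain h U e 0.
  exists 0%N, (fun=> 0), (fun=> 0); split => //; rewrite big_ord0 ?measure_ge0//.
  by rewrite subrr normr0 mulr0 addr0.
have : chain h U e b.
  pose A := [set x : R | 0 <= x /\ x <= b /\ chain h U e x].
  have A0 : A 0 by split=> //; split=> //; exact: ltW.
  have Ab : ubound A b by move=> x [_ []].
  have supA : has_sup A by split; [exists 0|exists b].
  pose c := sup A.
  have c_ge0 : 0 <= c by apply: ub_le_sup => //; exists b.
  have cb : c <= b by apply: ge_sup => //; exists 0.
  have [r r0 hr] := loc c.
  have [x [x0 [xb hx]] cx] := sup_adherent r0 supA.
  have xc : x <= c by apply: ub_le_sup => //; exists b.
  have hy y : c <= y -> y < c + r -> chain h U e y by move=> cy yr; exact: (hr x).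
  (* If c + r <= b, extending across the supremum c would give chains ending beyond it. *)
  have [bc|bc] := leP (c + r) b; last by apply: hy.
  have : c + r / 2 <= c.
    apply: ub_le_sup; first by exists b.
    split; first by lra.
    by split; [lra|apply: hy; lra].
  lra.
move=> [n [s [t [h1 h2 h3 h4]]]]; apply: le_trans h4 _; rewrite lerD2l; apply: ltW; apply: dP => //.
rewrite -lte_fin; apply: le_lt_trans h3 _; apply: le_lt_trans muU; apply: le_measure;
  rewrite ?inE//.
by apply: measurableI.
Qed.

(** What continuous coefficients buy: f minus the classical primitive of g is constant, so an
    equation known almost everywhere holds at every x > 0. *)
Lemma abs_cont_ae_derive f g : continuous f -> continuous g -> loc_abs_cont f ->
  {ae mu, forall x : R, 0 < x -> is_derive x 1 f (g x)} ->
  forall x : R, 0 < x -> is_derive x 1 f (g x).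
Proof.
move=> cf cg acf fg.
have cA := continuous_antideriv cg.
have gD (x : R) : 0 < x -> is_derive x 1 (antideriv g) (g x) by exact: is_derive_antideriv.
have acA : loc_abs_cont (antideriv g) by exact: loc_abs_cont_C1 gD.
have fE (b : R) : 0 < b -> f b = f 0 + antideriv g b.
  move=> b0; have := @abs_cont_ae_derive0
    (fun x => f x - antideriv g x) b b0 ltac:(cont) (loc_abs_contB acf acA b0).
  have -> : antideriv g 0 = 0 by rewrite antideriv_le0.
  rewrite subr0 => h; suff : f b - antideriv g b = f 0 by move=> <-; rewrite subrK.
  apply: h; move: fg; apply: filterS; first exact: (ae_filter_ringOfSetsType mu).
  move=> x h x0; have h1 := h x0; have h2 := gD x x0.
  by der_to; ring.
move=> x x0; apply: (@near_eq_is_derive _ _ _ (fun x => f 0 + antideriv g x)).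
  near=> y; rewrite -fE//; near: y; exact: lt_nbhsr.
by have h := gD x x0; der_to; ring.
Unshelve. all: by end_near. Qed.

End abs_cont_primitive.

(** * Primitives of integrable functions *)

Section integrable_primitive.
Context {R : realType}.
Notation mu := (@lebesgue_measure R).
Implicit Types (f g : R -> R) (a b x y : R).

Definition primitive f x : R := (\int[mu]_(t in `]-oo, x]) f t)%R.

Lemma primitiveB f x y : mu.-integrable setT (EFin \o f) -> x <= y ->
  primitive f y - primitive f x = (\int[mu]_(t in `]x, y]) f t)%R.
Proof.
move=> fi xy; rewrite /primitive Rintegral_itvB//.
exact: integrableS fi.
Qed.

Let integrable_norm f : mu.-integrable setT (EFin \o f) ->
  mu.-integrable setT (EFin \o (fun t => `|f t|)).
Proof. by move=> fi; exact: (integrable_abse fi). Qed.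

Lemma primitive_norm_le f x y : mu.-integrable setT (EFin \o f) -> x <= y ->
  `|primitive f y - primitive f x| <=
  primitive (fun t => `|f t|) y - primitive (fun t => `|f t|) x.
Proof.
move=> fi xy; rewrite !primitiveB//; last exact: integrable_norm.
by apply: le_normr_Rintegral => //; exact: integrableS fi.
Qed.

Lemma primitive_norm_bound f x : mu.-integrable setT (EFin \o f) ->
  0 <= primitive (fun t => `|f t|) x /\
  primitive (fun t => `|f t|) x <= (\int[mu]_t `|f t|)%R.
Proof.
move=> fi; have nfi := integrable_norm fi.
split; first by apply: Rintegral_ge0.
have : (\int[mu]_(t in setT) `|f t|)%R - primitive (fun t => `|f t|) x =
    (\int[mu]_(t in `]x, +oo[) `|f t|)%R.
  by rewrite /primitive -set_itvNyy Rintegral_itvB//; rewrite set_itvNyy.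
move=> h; rewrite -subr_ge0 h; exact: Rintegral_ge0.
Qed.

(** The ordered intervals are merged into one set of small measure, to which absolute continuity of
    the integral applies. Keeping the set to the left of [s m] makes the next interval disjoint from
    it. *)
Lemma abs_cont_on_primitive_norm f a b : mu.-integrable setT (EFin \o f) ->
  abs_cont_on a b (primitive (fun t => `|f t|)).
Proof.
move=> fi e e0; have nfi := integrable_norm fi.
have [d [d0 dP]] := integral_normr_continuous fi e0.
exists d => // n s t st ts std.
have key m : (m <= n)%N -> exists A : set R, [/\ measurable A,
    (m < n)%N -> A `<=` `]-oo, s m],
    (mu A <= (\sum_(i < m) (t i - s i))%R%:E)%E &
    (\int[mu]_(x in A) `|f x|)%R =
     \sum_(i < m) `|primitive (fun t => `|f t|) (t i) - primitive (fun t => `|f t|) (s i)|].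
  elim: m => [_|m IH mn].
    exists set0; split => //; first by move=> _; exact: sub0set.
    - by rewrite measure0 big_ord0.
    - by rewrite Rintegral_set0 big_ord0.
  have [A [mA As muA fA]] := IH (ltnW mn).
  have [asm [stm tbm]] := st m mn.
  have dis : A `&` `]s m, t m] = set0.
    apply/seteqP; split => // z/= [/(As mn)/=].
    by rewrite !in_itv/= => zs /andP[sz _]; move: sz; rewrite ltNge zs.
  exists (A `|` `]s m, t m]); split.
  - exact: measurableU.
  - move=> m1n z/= [/(As mn)/=|]; rewrite !in_itv/=.
      by move=> /le_trans; apply; apply: (le_trans stm); exact: ts.
    by move=> /andP[_ /le_trans]; apply; exact: ts.
  - have : (mu (A `|` `]s m, t m]) <= mu A + mu `]s m, t m])%E by exact: measureU2.
    move=> /le_trans; apply; rewrite big_ord_recr/= EFinD; apply: leeD => //.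
    rewrite lebesgue_measure_itv/= lte_fin.
    by move: stm; rewrite le_eqVlt => /predU1P[->|->]; rewrite ?ltxx ?subrr ?EFinB.
  - rewrite Rintegral_setU//; last 2 first.
    + by apply: integrableS nfi => //; exact: measurableU.
    + by apply/eqP; rewrite dis.
    rewrite big_ord_recr/= fA primitiveB//; congr (_ + _).
    by rewrite ger0_norm//; exact: Rintegral_ge0.
have [A [mA _ muA fA]] := key n (leqnn n).
by rewrite -fA; apply: dP => //; apply: le_lt_trans muA _; rewrite lte_fin.
Qed.

Lemma continuous_primitive_norm f : mu.-integrable setT (EFin \o f) ->
  continuous (primitive (fun t => `|f t|)).
Proof.
move=> fi x; apply/cvgrPdist_lt => /= e e0.
have [d d0 dP] := abs_cont_on_primitive_norm (x - 1) (x + 1) fi e0.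
have h y z : x - 1 <= y -> y <= z -> z <= x + 1 -> z - y < d ->
    `|primitive (fun t => `|f t|) z - primitive (fun t => `|f t|) y| < e.
  move=> y0 yz zx zyd.
  by have := dP 1%N (fun=> y) (fun=> z); rewrite !big_ord1; apply.
near=> y.
have yx1 : `|x - y| < 1 by near: y; exact: (nbhsx_ballx x 1).
have yxd : `|x - y| < d by near: y; exact: (nbhsx_ballx x d).
rewrite ltr_norml in yx1; rewrite ltr_norml in yxd.
move: yx1 yxd => /andP[y1 y2] /andP[y3 y4].
have [xy|/ltW yx] := leP x y; first by rewrite distrC; apply: h; lra.
by apply: h; lra.
Unshelve. all: by end_near. Qed.

Lemma continuous_primitive f : mu.-integrable setT (EFin \o f) -> continuous (primitive f).
Proof.
move=> fi x; apply/cvgrPdist_lt => /= e e0.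
have /cvgrPdist_lt/(_ e e0) := continuous_primitive_norm fi (x := x).
apply: filterS => y; apply: le_lt_trans.
have [yx|/ltW xy] := leP y x.
  by apply: le_trans (primitive_norm_le fi yx) _; exact: ler_norm.
rewrite distrC [leRHS]distrC.
by apply: le_trans (primitive_norm_le fi xy) _; exact: ler_norm.
Qed.

Lemma loc_abs_cont_primitive f : mu.-integrable setT (EFin \o f) -> loc_abs_cont (primitive f).
Proof.
move=> fi b b0; apply: (abs_cont_on_le (abs_cont_on_primitive_norm 0 b fi)) => x y x0 xy _.
by apply: le_trans (primitive_norm_le fi xy) _; exact: ler_norm.
Qed.

Lemma ae_is_derive_primitive f : mu.-integrable setT (EFin \o f) ->
  {ae mu, forall x, is_derive x 1 (primitive f) (f x)}.
Proof.
move=> fi.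
have : {ae mu, forall x, derivable (primitive f) x 1 /\ derive1 (primitive f) x = f x}.
  apply: FTC1Ny; first by move=> y; exact: integrableS fi.
  by apply: open_integrable_locally => //; exact: openT.
apply: filterS; first exact: (ae_filter_ringOfSetsType mu).
by move=> x [df <-]; rewrite derive1E; exact: derivableP.
Qed.

End integrable_primitive.

Opaque primitive.

(** * Reduction to continuous coefficients *)

Lemma is_derive_antideriv_window {R : realType} (f : R -> R) (x : R) : continuous f -> 0 < x ->
  is_derive x 1 (fun x : R => antideriv f (x + 1) - antideriv f x) (f (x + 1) - f x).
Proof.
move=> cf x0; have x10 : 0 < x + 1 by lra.
have h1 := is_derive_antideriv cf x0; have h2 := is_derive_antideriv cf x10.
have h3 : is_derive x 1 (fun y : R => y + 1) 1 by der_to; ring.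
by have h4 := @der_comp _ (antideriv f) (fun y : R => y + 1) x _ _ h2 h3; der_to; ring.
Qed.

Lemma continuous_shift1 {R : realType} (f : R -> R) : continuous f ->
  continuous (fun x : R => f (x + 1)).
Proof. by move=> cf; apply: (@contcomp _ f) => //; cont. Qed.

(** The window has length 1, so the difference of antiderivatives is a mean value of f. *)
Lemma antideriv_window_dist {R : realType} (f : R -> R) (c K x : R) : continuous f -> 0 <= x ->
  (forall t, x < t -> t < x + 1 -> `|f t - c| <= K) ->
  `|antideriv f (x + 1) - antideriv f x - c| <= K.
Proof.
move=> cf x0 fK; have cA := continuous_antideriv cf.
have : `|(antideriv f (x + 1) - c * (x + 1)) - (antideriv f x - c * x)| <= K * (x + 1) - K * x.
  apply: (@norm_derive_le _ (fun t => antideriv f t - c * t) (fun t => f t - c)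
    (fun t => K * t) (fun=> K) x (x + 1)); [by cont|by cont|by lra| | |exact: fK].
  - move=> t xt _; have h := is_derive_antideriv cf (le_lt_trans x0 xt).
    by der_to; ring.
  - by move=> t _ _; der_to; ring.
have e1 (a b : R) : a - c * (x + 1) - (b - c * x) = a - b - c by ring.
have e2 : K * (x + 1) - K * x = K by ring.
by rewrite e1 e2.
Qed.

(* Splitting off the mean of T over [x, x + 1]: the remainder Q and the derivative of the
   mean are both dominated by V (x + 1) - V x, which has a bounded primitive. *)
Lemma regularize_primitive {R : realType} (T V : R -> R) (Vm : R) :
  continuous T -> continuous V -> loc_abs_cont T ->
  (forall x y : R, x <= y -> `|T y - T x| <= V y - V x) ->
  (forall x : R, 0 <= V x /\ V x <= Vm) ->
  exists Q p B G : R -> R, exists M Gmax : R,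
  [/\ continuous Q, continuous p, continuous G & loc_abs_cont Q] /\
  [/\ forall x : R, 0 <= x -> `|Q x| <= B x, forall x : R, 0 <= x -> `|p x| <= B x,
      forall x : R, 0 <= x -> B x <= M, forall x : R, 0 < x -> is_derive x 1 G (B x) &
      forall x : R, 0 <= x -> 0 <= G x /\ G x <= Gmax] /\
  forall x t : R, 0 < x -> is_derive x 1 T t -> is_derive x 1 Q (t - (p x + Q x ^+ 2)).
Proof.
move=> cT cV acT TV Vb.
have cT1 := continuous_shift1 cT; have cV1 := continuous_shift1 cV.
have cAT := continuous_antideriv cT; have cAV := continuous_antideriv cV.
have cAT1 := continuous_shift1 cAT; have cAV1 := continuous_shift1 cAV.
have B00 (x : R) : 0 <= V (x + 1) - V x.
  by apply: le_trans (normr_ge0 _) (TV x (x + 1) _); lra.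
have B0m (x : R) : V (x + 1) - V x <= Vm.
  by have [? ?] := Vb x; have [? ?] := Vb (x + 1); lra.
have Vm0 : 0 <= Vm by exact: le_trans (B00 0) (B0m 0).
(* Introduced through an equation, Q stays a symbol for [cont] and [der]. *)
have [Q QE] : exists Q : R -> R, Q = fun x : R => T x - (antideriv T (x + 1) - antideriv T x).
  by eexists.
have QB0 (x : R) : 0 <= x -> `|Q x| <= V (x + 1) - V x.
  move=> x0; rewrite QE distrC; apply: antideriv_window_dist => // t xt tx.
  apply: le_trans (TV x t (ltW xt)) _; rewrite lerD2r.
  by have := TV t (x + 1) (ltW tx); have := normr_ge0 (T (x + 1) - T t); lra.
have cQ : continuous Q by rewrite QE; cont.
(* The factor 1 + Vm in the majorant accounts for Q^2 <= Vm (V (x + 1) - V x). Its primitive is 1 +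
   Vm times the mean of V over the window, hence bounded. *)
exists Q, (fun x => T (x + 1) - T x - Q x ^+ 2), (fun x => (1 + Vm) * (V (x + 1) - V x)),
  (fun x => (1 + Vm) * (antideriv V (x + 1) - antideriv V x)), ((1 + Vm) * Vm), ((1 + Vm) * Vm).
split; [split|split; [split|]].
- exact: cQ.
- by cont.
- by cont.
- rewrite QE; apply: loc_abs_contB => //.
  apply: (@loc_abs_cont_C1 _ _ (fun x => T (x + 1) - T x)); [by cont|by cont|].
  by move=> x x0; exact: is_derive_antideriv_window.
- by move=> x x0; apply: le_trans (QB0 x x0) _; rewrite ler_peMl//; lra.
- move=> x x0; apply: le_trans (ler_normB _ _) _; rewrite mulrDl mul1r; apply: lerD.
    by apply: TV; lra.
  by rewrite normrX expr2; apply: ler_pM => //; [exact: le_trans (QB0 x x0) _|exact: QB0].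
- by move=> x x0; rewrite ler_wpM2l//; lra.
- by move=> x x0; have h := is_derive_antideriv_window cV x0; der_to; ring.
- move=> x x0; have nV (z : R) : 0 <= z -> 0 <= V z by have [] := Vb z.
  have h0 : antideriv V x <= antideriv V (x + 1) by apply: antideriv_ge0_le => //; lra.
  have h1 : antideriv V (x + 1) - antideriv V x <= Vm.
    have := @antideriv_window_dist _ V 0 Vm x cV x0; rewrite subr0.
    move=> /(_ _)/(le_trans (ler_norm _)); apply => t xt _.
    by rewrite subr0 ger0_norm; have [] := Vb t.
  split; first by rewrite mulr_ge0 ?subr_ge0//; lra.
  by rewrite ler_wpM2l//; lra.
- move=> x t x0 hT; have h := is_derive_antideriv_window cT x0.
  by rewrite {1}QE; der_to; ring.
Qed.

(** The last clause is the Riccati form q = Q' + Q^2 + p, which turns phi'' = (x + q - lam) phi into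
    the system for phi and w = phi' - Q phi. Extending q by 0 to the left makes its primitive live
    on the whole line. *)
Lemma regularized_potential {R : realType} (q : R -> R) :
  (@lebesgue_measure R).-integrable `[0, +oo[ (EFin \o q) ->
  exists Q p B G : R -> R, exists M Gmax : R,
  [/\ continuous Q, continuous p, continuous G & loc_abs_cont Q] /\
  [/\ forall x : R, 0 <= x -> `|Q x| <= B x, forall x : R, 0 <= x -> `|p x| <= B x,
      forall x : R, 0 <= x -> B x <= M, forall x : R, 0 < x -> is_derive x 1 G (B x) &
      forall x : R, 0 <= x -> 0 <= G x /\ G x <= Gmax] /\
  {ae (@lebesgue_measure R), forall x : R, 0 < x -> is_derive x 1 Q (q x - (p x + Q x ^+ 2))}.
Proof.
move=> iq.
have iqt : (@lebesgue_measure R).-integrable setT (EFin \o (q \_ `[0, +oo[)).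
  by move: iq; rewrite integrable_mkcond//= (restrict_EFin q).
have [Q [p [B [G [M [Gmax [h1 [h2 h3]]]]]]]] := regularize_primitive
  (continuous_primitive iqt) (continuous_primitive_norm iqt) (loc_abs_cont_primitive iqt)
  (fun x y => @primitive_norm_le _ _ x y iqt) (fun x => primitive_norm_bound x iqt).
exists Q, p, B, G, M, Gmax; split => //; split => //.
move: (ae_is_derive_primitive iqt); apply: filterS;
  first exact: (ae_filter_ringOfSetsType (@lebesgue_measure R)).
by move=> x hT x0; apply: h3 => //; move: hT; rewrite patchE mem_set//= in_itv/= andbT ltW.
Qed.

(** * Neumann eigenvalues and square integrable solutions *)

Section neumann.
Context {R : realType} (Q p : R -> R) (M : R).
Hypotheses (cQ : continuous Q) (cp : continuous p).
Hypotheses (QM : forall x, 0 <= x -> `|Q x| <= M)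
  (pM : forall x, 0 <= x -> `|p x| <= M).

Let M0 : 0 <= M. Proof. exact: le_trans (QM (lexx 0)). Qed.

Variables (t0 : R) (th : R -> R -> R).
Hypotheses (cth : forall lam, continuous (th lam)) (th0 : forall lam, th lam 0 = t0)
  (thD : forall lam x : R, 0 < x -> is_derive x 1 (th lam) (angle_rhs Q p lam x (th lam x))).

(** The sum of the squared differences satisfies a linear differential inequality and vanishes at 0,
    so the barrier keeps it there. *)
Lemma solution_unique (lam r : R) (u w : R -> R) : continuous u -> continuous w ->
  (forall x : R, 0 < x -> is_derive x 1 u (Q x * u x + w x)) ->
  (forall x : R, 0 < x -> is_derive x 1 w ((x - lam + p x) * u x - Q x * w x)) ->
  u 0 = r * solu Q p th lam 0 -> w 0 = r * solw Q p th lam 0 ->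
  forall x : R, 0 <= x -> u x = r * solu Q p th lam x.
Proof.
move=> cu cw uD wD u0 w0 x x0.
have c1 := continuous_solu cQ cp cth (lam := lam);
  have c2 := continuous_solw cQ cp cth (lam := lam).
have M0' := M0.
suff : (u x - r * solu Q p th lam x) ^+ 2 + (w x - r * solw Q p th lam x) ^+ 2 <= 0.
  have := sqr_ge0 (w x - r * solw Q p th lam x) => h1 h2.
  have /eqP : (u x - r * solu Q p th lam x) ^+ 2 == 0.
    by rewrite eq_le sqr_ge0 andbT; lra.
  by move=> /eqP; rewrite sqrf_eq0 subr_eq0 => /eqP.
apply: (@differential_barrier _
  (fun x => (u x - r * solu Q p th lam x) ^+ 2 + (w x - r * solw Q p th lam x) ^+ 2)
  (fun x => 2 * Q x * ((u x - r * solu Q p th lam x) ^+ 2 - (w x - r * solw Q p th lam x) ^+ 2) +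
    2 * (1 + x - lam + p x) * ((u x - r * solu Q p th lam x) * (w x - r * solw Q p th lam x)))
  (2 * M + (1 + x + `|lam| + M)) 0 x) => //.
- by cont.
- move=> y y0 _; have h1 := uD y y0; have h2 := wD y y0.
  have h3 := is_derive_solu cQ cp cth thD lam y0; have h4 := is_derive_solw cQ cp cth thD lam y0.
  by der_to; ring.
- move=> y y0 yx _.
  move: (u y - _) (w y - _) => a b.
  have a2 := sqr_ge0 a; have b2 := sqr_ge0 b.
  have := QM (ltW y0); have := pM (ltW y0); rewrite !ler_norml => /andP[p1 p2] /andP[Q1 Q2].
  have := ler_norm lam; have := ler_norm (- lam); rewrite normrN => l1 l2.
  have h1 : 2 * Q y * (a ^+ 2 - b ^+ 2) <= 2 * M * (a ^+ 2 + b ^+ 2) by nra.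
  have sp := sqr_ge0 (a + b); have sm := sqr_ge0 (a - b).
  have [ab1 ab2] : 2 * (a * b) <= a ^+ 2 + b ^+ 2 /\ - (2 * (a * b)) <= a ^+ 2 + b ^+ 2.
    by split; lra.
  have h2 : 2 * (1 + y - lam + p y) * (a * b) <= (1 + x + `|lam| + M) * (a ^+ 2 + b ^+ 2).
    have [ab0|ab0] := leP 0 (a * b).
      have : (1 + y - lam + p y) * (2 * (a * b)) <= (1 + x + `|lam| + M) * (2 * (a * b)).
        by apply: ler_wpM2r; lra.
      have : (1 + x + `|lam| + M) * (2 * (a * b)) <= (1 + x + `|lam| + M) * (a ^+ 2 + b ^+ 2).
        by apply: ler_wpM2l; lra.
      lra.
    have : - (1 + y - lam + p y) * (- (2 * (a * b))) <= (1 + x + `|lam| + M) * (- (2 * (a * b))).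
      by apply: ler_wpM2r; lra.
    have : (1 + x + `|lam| + M) * (- (2 * (a * b))) <= (1 + x + `|lam| + M) * (a ^+ 2 + b ^+ 2).
      by apply: ler_wpM2l; lra.
    lra.
  move: h1 h2; lra.
- by rewrite u0 w0 !subrr expr0n addr0.
Qed.

Variable q : R -> R.
Notation mu := (@lebesgue_measure R).
Hypotheses (acQ : loc_abs_cont Q)
  (aeQ : {ae mu, forall x : R, 0 < x -> is_derive x 1 Q (q x - (p x + Q x ^+ 2))})
  (t0E : t0 = pi / 2 + atan (Q 0)).

Let sin_t0 : sin t0 = cos (atan (Q 0)).
Proof. by rewrite t0E addrC sinDpihalf. Qed.

Let sin_t0_gt0 : 0 < sin t0.
Proof. by rewrite sin_t0; apply: cos_gt0_pihalf; rewrite atan_gtNpi2 atan_ltpi2. Qed.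

(** The Neumann condition for the quasi-derivative: phi' 0 = 0 reads w 0 = - Q 0 phi 0. *)
Let cos_t0 : cos t0 = - Q 0 * sin t0.
Proof.
rewrite t0E addrC cosDpihalf sinDpihalf mulNr; congr (- _).
have c0 : cos (atan (Q 0)) != 0.
  by apply: lt0r_neq0; apply: cos_gt0_pihalf; rewrite atan_gtNpi2 atan_ltpi2.
by have := atanK (Q 0); rewrite /tan => {2}<-; rewrite divfK.
Qed.

Let amplitude0 lam : amplitude Q p th lam 0 = 1.
Proof. by rewrite /amplitude antideriv_le0// expR0. Qed.

Let solu0 lam : solu Q p th lam 0 = sin t0.
Proof. by rewrite /solu amplitude0 th0 mul1r. Qed.

Let solw0 lam : solw Q p th lam 0 = cos t0.
Proof. by rewrite /solw amplitude0 th0 mul1r. Qed.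

Let csolu lam : continuous (solu Q p th lam). Proof. exact: continuous_solu. Qed.
Let csolw lam : continuous (solw Q p th lam). Proof. exact: continuous_solw. Qed.
Let soluD := is_derive_solu cQ cp cth thD.
Let solwD := is_derive_solw cQ cp cth thD.

Let ae_filter : Filter (almost_everywhere mu) := ae_filter_ringOfSetsType mu.

Lemma square_integrable_neumann (lam : R) : square_integrable_solu Q p th lam ->
  neumann_eigenvalue q lam.
Proof.
move=> [K hK]; have aeF := ae_filter.
have cu := @csolu lam; have cw := @csolw lam.
have acu : loc_abs_cont (solu Q p th lam).
  apply: (@loc_abs_cont_C1 _ _ (fun x => Q x * solu Q p th lam x + solw Q p th lam x)) => //.
  - by cont.
  - by move=> x; exact: soluD.
have acw : loc_abs_cont (solw Q p th lam).
  apply: (@loc_abs_cont_C1 _ _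
    (fun x => (x - lam + p x) * solu Q p th lam x - Q x * solw Q p th lam x)) => //.
  - by cont.
  - by move=> x; exact: solwD.
exists (solu Q p th lam), (fun x => solw Q p th lam x + Q x * solu Q p th lam x).
split=> //; split; [|split; [|split; [|split; [|split]]]].
- by apply: loc_abs_contD => //; exact: loc_abs_contM.
- apply: (@filterE _ _ ae_filter) => x; rewrite inE/= in_itv/= andbT => x0.
  by rewrite addrC; exact: soluD.
- apply: filterS aeQ => x hx; rewrite inE/= in_itv/= andbT => x0.
  have d1 := hx x0; have d2 := soluD lam x0; have d3 := solwD lam x0.
  have [d dE] : is_derive x 1 (fun x => solw Q p th lam x + Q x * solu Q p th lam x)
    ((x + q x - lam) * solu Q p th lam x) by der_to; ring.
  by split=> //; rewrite dE; ring.
- by rewrite solu0 solw0 cos_t0; ring.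
- pose u2 (x : R) : R := solu Q p th lam x ^+ 2.
  have cu2 : continuous u2 by rewrite /u2; cont.
  have u20 (x : R) : 0 <= u2 x by rewrite sqr_ge0.
  have mono : nondecreasing_fun (antideriv u2).
    move=> x y xy; have [x0|x0] := leP 0 x; first exact: antideriv_ge0_le.
    rewrite (antideriv_le0 _ (ltW x0)); have [y0|y0] := leP 0 y;
      last by rewrite (antideriv_le0 _ (ltW y0)).
    by rewrite -(@antideriv_le0 _ u2 0)//; apply: antideriv_ge0_le.
  have ub : has_ubound (range (antideriv u2)).
    exists (Num.max K 0) => _ [x _ <-]; have [x0|x0] := leP 0 x; first by rewrite le_max hK.
    by rewrite (antideriv_le0 _ (ltW x0)) le_max lexx orbT.
  have cvg := nondecreasing_cvgr mono ub.
  have cA := continuous_antideriv cu2.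
  have dA (x : R) : 0 < x -> is_derive x 1 (antideriv u2) (u2 x) by exact: is_derive_antideriv.
  (* The antiderivative is monotone and bounded, so the fundamental theorem at infinity gives a
     finite integral. *)
  have E : (\int[mu]_(x in `[0%R, +oo[) (u2 x)%:E =
      (sup (range (antideriv u2)))%:E - (antideriv u2 0)%:E)%E.
    apply: ge0_continuous_FTC2y => //.
    - exact: continuous_subspaceT.
    - by move=> x x0; case: (dA x x0).
    - by apply: cvg_at_right_filter; exact: cA.
    - by move=> x; rewrite in_itv/= andbT => x0; rewrite derive1E; case: (dA x x0).
  apply/integrableP; split.
    by apply/measurable_realfun.measurable_EFinP; apply: measurable_funTS;
      exact: measurable_realfun.continuous_measurable_fun.
  under eq_integral do rewrite gee0_abs ?lee_fin ?sqr_ge0//.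
  by rewrite E -EFinB ltry.
- move=> [N [mN N0 hN]].
  (* The solution starts at sin t0 > 0, so it is nonzero on an interval of positive length, which no
     null set contains. *)
  have [r r0 hr] : exists2 r : R, 0 < r & forall x : R, 0 <= x -> x < r -> 0 < solu Q p th lam x.
    have e0 : 0 < solu Q p th lam 0 by rewrite solu0.
    have /cvgrPdist_lt/(_ _ e0)/nbhs_ballP[r r0 hr] := cu 0.
    exists r => // x x0 xr; have := hr x; rewrite /ball/= sub0r normrN ger0_norm// => /(_ xr).
    by rewrite ltr_norml; lra.
  have sub : `[0, (r / 2)] `<=` N.
    move=> x/=; rewrite in_itv/= => /andP[x0 xr]; apply: hN => /= h.
    have := hr x x0 ltac:(lra); rewrite h ?ltxx// inE/= in_itv/= x0//.
  have : (mu `[0%R, (r / 2)%R] <= mu N)%E by apply: le_measure; rewrite ?inE.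
  rewrite N0 lebesgue_measure_itv/= lte_fin divr_gt0//.
  by rewrite -EFinD lee_fin subr0 leNgt divr_gt0.
Qed.

Lemma neumann_square_integrable (lam : R) : neumann_eigenvalue q lam ->
  square_integrable_solu Q p th lam.
Proof.
move=> [phi [dphi [acphi [acdphi [phiD [dphiD [dphi0 [iphi phi0]]]]]]]]; have aeF := ae_filter.
(* The eigenfunction is arbitrary on the negative axis; clamping makes it continuous on the whole
   line without changing it for x >= 0. *)
have [u uE] : exists u : R -> R, u = fun x : R => phi (Num.max x 0) by eexists.
have [d dE] : exists d : R -> R, d = fun x : R => dphi (Num.max x 0) by eexists.
have cu : continuous u by rewrite uE; exact: loc_abs_cont_continuous.
have cd : continuous d by rewrite dE; exact: loc_abs_cont_continuous.
have u_ge0 (x : R) : 0 <= x -> phi x = u x by move=> x0; rewrite uE max_l.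
have d_ge0 (x : R) : 0 <= x -> dphi x = d x by move=> x0; rewrite dE max_l.
have acu : loc_abs_cont u := loc_abs_cont_ext u_ge0 acphi.
have acd : loc_abs_cont d := loc_abs_cont_ext d_ge0 acdphi.
have near_u (x a : R) : 0 < x -> is_derive x 1 phi a -> is_derive x 1 u a.
  move=> x0; apply: near_eq_is_derive; near=> y; apply: u_ge0; apply: ltW.
  by near: y; exact: lt_nbhsr.
have near_d (x a : R) : 0 < x -> is_derive x 1 dphi a -> is_derive x 1 d a.
  move=> x0; apply: near_eq_is_derive; near=> y; apply: d_ge0; apply: ltW.
  by near: y; exact: lt_nbhsr.
have [w wE] : exists w : R -> R, w = fun x : R => d x - Q x * u x by eexists.
have cw : continuous w by rewrite wE; cont.
have acw : loc_abs_cont w by rewrite wE; apply: loc_abs_contB => //; exact: loc_abs_contM.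
have uD (x : R) : 0 < x -> is_derive x 1 u (Q x * u x + w x).
  apply: (@abs_cont_ae_derive _ u (fun x => Q x * u x + w x)) => //; first by cont.
  apply: filterS phiD => y hy y0; apply: (der_eq (near_u y _ y0 (hy _))).
    by rewrite inE/= in_itv/= y0.
  by rewrite d_ge0 ?ltW// wE; ring.
have wD (x : R) : 0 < x -> is_derive x 1 w ((x - lam + p x) * u x - Q x * w x).
  apply: (@abs_cont_ae_derive _ w (fun x => (x - lam + p x) * u x - Q x * w x)) => //;
    first by cont.
  apply: filterS2 dphiD aeQ => y hy hQ y0.
  have [d1 d2] := hy ltac:(by rewrite inE/= in_itv/= y0).
  have h1 := near_d y _ y0 (derivableP d1); have h2 := hQ y0; have h3 := uD y y0.
  have {}d2 : 'D_1 dphi y = (y + q y - lam) * u y.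
    by move: d2; rewrite u_ge0 ?ltW//; lra.
  rewrite d2 in h1; rewrite {1}wE; der_to; rewrite [in RHS]wE.
  have : w y = d y - Q y * u y by rewrite wE.
  by move=> ->; ring.
(* The Neumann condition fixes the initial pair up to a factor, so the eigenfunction is a multiple
   of [solu]; r = 0 would make it vanish. *)
pose r := u 0 / sin t0.
have s0 : sin t0 != 0 by exact: lt0r_neq0.
have ur : forall x : R, 0 <= x -> u x = r * solu Q p th lam x.
  apply: (@solution_unique lam r u w) => //.
  - by rewrite solu0 /r divfK.
  - by rewrite solw0 cos_t0 wE -d_ge0// dphi0 /r; field.
have r0 : r != 0.
  apply: contra_notN phi0 => /eqP r0; apply: (@filterE _ _ ae_filter) => x.
  by rewrite inE/= in_itv/= andbT => x0; rewrite u_ge0// ur// r0 mul0r.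
have cs := @csolu lam.
have cu2 : continuous (fun x => u x ^+ 2) by cont.
have cA := continuous_antideriv cu2.
exists (r ^- 2 * (\int[mu]_(x in `[0, +oo[) (phi x ^+ 2))%R) => x x0.
have -> : antideriv (fun t => solu Q p th lam t ^+ 2) x =
    r ^- 2 * antideriv (fun t => u t ^+ 2) x - r ^- 2 * antideriv (fun t => u t ^+ 2) 0.
  apply: (@antideriv_eq _ _ (fun x => r ^- 2 * antideriv (fun t => u t ^+ 2) x)) => //; try by cont.
  move=> y y0 _; have h := is_derive_antideriv cu2 y0.
  by der_to; rewrite (ur y (ltW y0)); field.
rewrite (antideriv_le0 _ (lexx 0)) mulr0 subr0 ler_wpM2l ?invr_ge0 ?sqr_ge0// antiderivE.
rewrite (_ : (\int[mu]_(t in `[0, x]) (u t ^+ 2))%R = (\int[mu]_(t in `[0, x]) (phi t ^+ 2))%R);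
  last first.
  by apply: eq_Rintegral => t; rewrite inE/= in_itv/= => /andP[t0' _]; rewrite u_ge0.
rewrite -subr_ge0 Rintegral_itvB//.
by apply: Rintegral_ge0 => t _; exact: sqr_ge0.
Unshelve. all: by end_near. Qed.

End neumann.

(** * Counting *)

(** The index is monotone and injective on eigenvalues >= 1 and takes every value from n0 on, so
    from the eigenvalue of index n0 onwards it rises by exactly 1 at each step. *)
Lemma enumeration_index {R : realType} (eig : R -> Prop) (I : R -> nat -> Prop) (lam : nat ->
  R) n0 :
  (forall k : nat, (1 <= k)%N -> lam k < lam k.+1) ->
  (forall mu : R, eig mu <-> exists2 k : nat, (1 <= k)%N & lam k = mu) ->
  (forall mu : R, 1 <= mu -> eig mu -> exists n, I mu n) ->
  (forall (mu : R) n, 1 <= mu -> I mu n -> eig mu) ->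
  (forall (mu nu : R) m n, 1 <= mu -> mu <= nu -> I mu m -> I nu n -> (m <= n)%N) ->
  (forall (mu nu : R) n, 1 <= mu -> mu < nu -> I mu n -> I nu n -> False) ->
  (forall n, (n0 <= n)%N -> exists2 mu : R, 1 <= mu & I mu n) ->
  exists2 k0 : nat, (1 <= k0)%N & forall j, 1 <= lam (k0 + j)%N /\ I (lam (k0 + j)%N) (n0 + j)%N.
Proof.
move=> lamS lamE eigI Ieig Ile Ineq Iex.
have lamle i j : (1 <= i)%N -> lam i <= lam (i + j)%N.
  move=> i1; elim: j => [|j IH]; first by rewrite addn0.
  by rewrite addnS (le_trans IH)// ltW// lamS// ltn_addr.
have [mu0 mu01 I0] := Iex n0 (leqnn n0).
have [k0 k01 k0E] := (lamE mu0).1 (Ieig _ _ mu01 I0).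
exists k0 => //; elim => [|j [IH1 IH]]; first by rewrite !addn0 k0E.
have kj1 : (1 <= k0 + j)%N by rewrite ltn_addr.
have kS := lamS _ kj1.
have l1 : 1 <= lam (k0 + j.+1)%N by rewrite addnS (le_trans IH1)// ltW.
split=> //.
have [n' In'] : exists n, I (lam (k0 + j.+1)%N) n.
  by apply: eigI => //; apply/lamE; exists (k0 + j.+1)%N; rewrite // addnS.
have [mu mu1 Imu] := Iex (n0 + j.+1)%N (leq_addr _ _).
have [m m1 mE] := (lamE mu).1 (Ieig _ _ mu1 Imu).
have lt_mu : lam (k0 + j)%N < mu.
  rewrite ltNge; apply/negP => h; have := Ile _ _ _ _ mu1 h Imu IH.
  by rewrite leq_add2l ltnn.
(* The eigenvalue of index n0 + j + 1 sits at a later position m, so the next eigenvalue has at most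
   this index; injectivity excludes n0 + j. *)
have km : (k0 + j < m)%N.
  rewrite ltnNge; apply/negP => mk; have := lamle m (k0 + j - m)%N m1.
  by rewrite subnKC// mE leNgt lt_mu.
have n'le : (n' <= n0 + j.+1)%N.
  apply: (Ile _ _ _ _ l1 _ In' Imu); rewrite -mE -(subnKC km) addnS; apply: lamle.
  by [].
have n'ge : (n0 + j <= n')%N by apply: (Ile _ _ _ _ IH1 _ IH In'); rewrite addnS ltW.
have n'neq : n' <> (n0 + j)%N.
  move=> e; rewrite e in In'; apply: (Ineq _ (lam (k0 + j.+1)%N) _ IH1 _ IH In').
  by rewrite addnS.
suff <- : n' = (n0 + j.+1)%N by [].
apply/eqP; rewrite eqn_leq n'le addnS ltn_neqAle n'ge andbT; apply/eqP => e; exact/n'neq/esym.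
Qed.

(** Factor both differences by Y - Z and use (Y + Z) Z <= Y^2 + Y Z + Z^2. *)
Lemma cube_close_square_close {R : realType} (Y Z D : R) : 0 <= Y -> 0 < Z ->
  `|Y ^+ 3 - Z ^+ 3| <= D ->
  `|Y ^+ 2 - Z ^+ 2| <= D / Z.
Proof.
move=> Y0 Z0 h; rewrite ler_pdivlMr//; apply: le_trans h.
rewrite (_ : Y ^+ 3 - Z ^+ 3 = (Y - Z) * (Y ^+ 2 + Y * Z + Z ^+ 2)); last by ring.
rewrite (_ : Y ^+ 2 - Z ^+ 2 = (Y - Z) * (Y + Z)); last by ring.
have Y2 := sqr_ge0 Y; have Z2 := sqr_ge0 Z.
have YZ : 0 <= Y * Z by rewrite mulr_ge0// ltW.
rewrite !normrM -mulrA (ger0_norm (_ : 0 <= Y + Z)); last by lra.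
rewrite (ger0_norm (_ : 0 <= Y ^+ 2 + Y * Z + Z ^+ 2)); last by lra.
by rewrite ler_wpM2l//; lra.
Qed.

(** With Z = a^(1/3), the bound D / Z equals D Z^2 / a, and k <= 2 a turns it into the relative
    error 2 D / k. *)
Lemma powR_close {R : realType} (l a D k : R) : 0 <= l -> 0 < k -> k <= 2 * a ->
  `|Num.sqrt l ^+ 3 - a| <= D -> `|l - a `^ (2 / 3)| <= 2 * D * a `^ (2 / 3) / k.
Proof.
move=> l0 k0 ka h; have a0 : 0 < a by lra.
have D0 : 0 <= D by exact: le_trans h.
pose Z := a `^ (1 / 3).
have Z0 : 0 < Z by exact: powR_gt0.
have Z3 : Z ^+ 3 = a.
  rewrite -powR_mulrn ?ltW// -powRrM (_ : 1 / 3 * 3%:R = 1); last by field.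
  by rewrite powRr1// ltW.
have Z2 : a `^ (2 / 3) = Z ^+ 2.
  rewrite -powR_mulrn ?ltW// -powRrM; by congr (_ `^ _); field.
rewrite Z2 -{1}(sqr_sqrtr l0).
apply: le_trans (cube_close_square_close _ Z0 _) _; [exact: sqrtr_ge0|by rewrite Z3; exact: h|].
rewrite ler_pdivrMr// (_ : 2 * D * Z ^+ 2 / k * Z = D * (2 * Z ^+ 3) / k); last by ring.
by rewrite ler_pdivlMr// Z3 ler_wpM2l.
Qed.

(* lam k (k >= 1) is the k-th Neumann eigenvalue, listed increasingly. *)
Theorem theorem3p8 (R : realType) (q : R -> R) (lam : nat -> R) :
  (@lebesgue_measure R).-integrable `[0, +oo[%classic (EFin \o q) ->
  (forall k : nat, (1 <= k)%N -> lam k < lam k.+1) ->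
  (forall mu : R, neumann_eigenvalue q mu <-> exists2 k : nat, (1 <= k)%N & lam k = mu) ->
  exists C : R, exists K : nat, forall k : nat, (K <= k)%N ->
    `| lam k - (3 / 2 * pi * (k%:R - 3 / 4)) `^ (2 / 3) |
      <= C * (3 / 2 * pi * (k%:R - 3 / 4)) `^ (2 / 3) / k%:R.
Proof.
move=> iq lamS lamE.
have [Q [p [B [G [M [Gmax [[cQ cp cG acQ] [[QB pB BM GD Gb] aeQ]]]]]]]] := regularized_potential iq.
have QM (x : R) : 0 <= x -> `|Q x| <= M by move=> x0; exact: le_trans (QB x x0) (BM x x0).
have pM (x : R) : 0 <= x -> `|p x| <= M by move=> x0; exact: le_trans (pB x x0) (BM x x0).
have M0 : 0 <= M by exact: le_trans (QM 0 (lexx 0)).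
have pi0 := @pi_gt0 R.
pose t0 : R := pi / 2 + atan (Q 0).
have t00 : 0 <= t0 by have := atan_gtNpi2 (Q 0); rewrite /t0; lra.
have [th thP] := choice (angle_exists cQ cp QM pM t0).
have cth l : continuous (th l) by have [] := thP l.
have th0 l : th l 0 = t0 by have [] := thP l.
have thD (l x : R) : 0 < x -> is_derive x 1 (th l) (angle_rhs Q p l x (th l x)).
  by have [_ _] := thP l; exact.
have [C hC] := angle_asymptotics QM pM t00 cth th0 thD QB pB cG GD Gb.
have nS n : n.+1%:R * pi = n%:R * pi + pi :> R by rewrite -natr1; ring.
pose I := angle_index M th.
have I_close (l : R) n : 1 <= l -> I l n -> `|n%:R * pi - 2 / 3 * Num.sqrt l ^+ 3| <= C + pi.
  move=> l1 /(_ (l + (M + 1)) (lexx _)) [h1 h2]; have := hC l l1.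
  by rewrite nS in h2; rewrite !ler_norml; lra.
(* From n0 on, the angle at the parameter 1 lies below n pi + pi/2, so 1 can serve as lower
   parameter. *)
pose n0 := (Num.truncn (th 1 (1 + (M + 1)) / pi)).+1.
have n0P : th 1 (1 + (M + 1)) <= n0%:R * pi.
  by rewrite -ler_pdivrMr// ltW// truncnS_gt.
have Iex n : (n0 <= n)%N -> exists2 l : R, 1 <= l & I l n.
  (* Chosen so that (2/3) y^3 - C >= (n+1) pi; the square y^2 is the upper parameter, with square
     root y. *)
  move=> n0n; pose y : R := 1 + 3 / 2 * (`|n.+1%:R * pi| + `|C|).
  have y1 : 1 <= y by rewrite lerDl mulr_ge0 ?addr_ge0.
  have y21 : 1 <= y ^+ 2 by rewrite exprn_ege1.
  apply: (angle_index_exists QM pM cth th0 thD (l1 := 1) (l2 := y ^+ 2)) => //.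
    apply: le_trans n0P _; rewrite -[leLHS]addr0; apply: lerD; last by lra.
    by rewrite ler_wpM2r ?ler_nat// ltW.
  have := hC (y ^+ 2) y21; rewrite sqrtr_sqr (ger0_norm (_ : 0 <= y)); last by lra.
  have y3 : y <= y ^+ 3 by rewrite exprS ler_peMr//; lra.
  have := ler_norm (n.+1%:R * pi : R); have := ler_norm C.
  by move: y3; rewrite {1}/y ler_norml; lra.
have l_ge0 (l : R) : 1 <= l -> 0 <= l by lra.
have eigE l : neumann_eigenvalue q l <-> square_integrable_solu Q p th l.
  split; first exact: (neumann_square_integrable cQ cp QM pM cth th0 thD acQ aeQ erefl).
  exact: (square_integrable_neumann cQ cp cth th0 thD acQ aeQ erefl).
have [k0 k01 Ik] := @enumeration_index _ (neumann_eigenvalue q) I lam n0 lamS lamE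
  (fun l l1 h => square_integrable_angle_index cQ cp QM pM t00 cth th0 thD
    (l_ge0 l l1) ((eigE l).1 h))
  (fun l n l1 h => (eigE l).2 (angle_index_square_integrable cQ cp QM pM cth thD (l_ge0 l l1) h))
  (fun l1 l2 m n h => angle_index_le QM pM cth th0 thD (l_ge0 l1 h))
  (fun l1 l2 n h => angle_index_neq cQ cp QM pM cth th0 thD (l_ge0 l1 h))
  Iex.
(* The first part is the angle error, the second the distance from n = n0 + k - k0 to k - 3/4, both
   scaled by 3/2. *)
pose D := 3 / 2 * (C + pi) + 3 / 2 * pi * `|n0%:R - k0%:R + 3 / 4|.
exists (2 * D), k0 => k k0k.
have [l1 Il] := Ik (k - k0)%N; rewrite subnKC// in l1 Il.
have k1 : 1 <= k%:R :> R by rewrite ler1n (leq_trans k01).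
have close := I_close _ _ l1 Il.
apply: powR_close; [exact: l_ge0|by lra| |].
  have pi2 := @pi_ge2 R.
  have : 2 * (k%:R - 3 / 4) <= pi * (k%:R - 3 / 4) :> R by rewrite ler_wpM2r//; lra.
  lra.
rewrite natrD natrB// in close.
have h : `|3 / 2 * pi * (n0%:R - k0%:R + 3 / 4)| = 3 / 2 * pi * `|n0%:R - k0%:R + 3 / 4| :> R.
  by rewrite normrM ger0_norm// mulr_ge0// ltW.
have {}h : `|3 / 2 * pi * (n0%:R - k0%:R + 3 / 4)| <=
    3 / 2 * pi * `|n0%:R - k0%:R + 3 / 4| :> R by rewrite h.
move: close h; rewrite /D; move: (`|n0%:R - k0%:R + 3 / 4|) => E.
rewrite !ler_norml; lra.
Qed.
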